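(* Let $\mathcal{N}$ and $\mathcal{M}$ be nests of order type $\omega$ with finite rank atoms of dimensions $n_k$ and $m_k$, respectively, for $k\ge1$. If there are constants $0<c\le d$ such that $cn_k\le m_k\le dn_k$ for all $k\ge1$, then $$\mathrm{rtsr}(\mathcal{T}(\mathcal{N}))=\mathrm{rtsr}(\mathcal{T}(\mathcal{M})).$$
   Context: A nest of order type $\omega$ on a Hilbert space $\mathcal{H}$ is a family $\mathcal{N}=\{N_k,\mathcal{H}:k\ge0\}$ of closed subspaces with $\{0\}=N_0<N_1<N_2<\cdots$ and $\bigcup_k N_k$ dense in $\mathcal{H}$; its atoms are $N_k\ominus N_{k-1}$, $k\ge1$, in this order. The nest algebra $\mathcal{T}(\mathcal{N})$ is the algebra of all $T\in\mathcal{B}(\mathcal{H})$ with $TN\subset N$ for every $N\in\mathcal{N}$. For a unital Banach algebra $\mathfrak{A}$, $\mathrm{rtsr}(\mathfrak{A})$ (right topological stable rank) is the least positive integer $n$ such that the set of $(a_1,\dots,a_n)\in\mathfrak{A}^n$ for which there is $(b_1,\dots,b_n)\in\mathfrak{A}^n$ with $\sum_{i=1}^n a_ib_i=1$ is dense in $\mathfrak{A}^n$; it is $\infty$ if no such $n$ exists. *)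

(* Defs.v *)
From HB Require Import structures.
From mathcomp Require Import all_boot all_order all_algebra.
From mathcomp Require Import all_classical all_reals all_analysis.
From mathcomp Require Import complex.

Set Implicit Arguments.
Unset Strict Implicit.
Unset Printing Implicit Defensive.

Import Order.TTheory GRing.Theory Num.Def Num.Theory.
Import numFieldNormedType.Exports.

Local Open Scope classical_set_scope.
Local Open Scope complex_scope.
Local Open Scope ring_scope.

(* HB does not accept a join of GRing.PzRing with the normed module structures
   (normed rings are forced to be numDomainTypes), so the multiplication is
   part of this mixin. *)
HB.mixin Record isBanachAlgebra (K : numFieldType) A
    of CompleteNormedModule K A := {
  bamul : A -> A -> A ;
  baone : A ;
  bamulA : associative bamul ;
  bamul1 : right_id baone bamul ;
  ba1mul : left_id baone bamul ;
  bamul_linearl : forall b, linear (bamul ^~ b) ;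
  bamul_linearr : forall a, linear (bamul a) ;
  ler_norm_bamul : forall a b, `|bamul a b| <= `|a| * `|b| ;
  norm_baone : `|baone| = 1
}.

#[short(type="banachAlgType")]
HB.structure Definition BanachAlgebra (K : numFieldType) :=
  {A of CompleteNormedModule K A & isBanachAlgebra K A}.

Section Rtsr.
Variables (K : numFieldType) (A : banachAlgType K).

(* 'rV[A]_n, i.e. A^n, carries the product topology. *)
Definition right_unimodular (n : nat) : set 'rV[A]_n :=
  [set a | exists b : 'rV[A]_n, \sum_(i < n) bamul (a 0 i) (b 0 i) = baone].

Definition rtsr_candidate : pred nat :=
  fun n => `[< (0 < n)%N /\ dense (@right_unimodular n) >].

(* None stands for infinity. *)
Definition rtsr : option nat :=
  if pselect (exists n, rtsr_candidate n) is left ex then Some (ex_minn ex)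
  else None.

End Rtsr.

HB.mixin Record CompleteNormedModule_isHilbert (R : realType) H
    of CompleteNormedModule R[i] H := {
  inner : {dot H for (@conjC R[i])} ;
  inner_norm : forall x : H, inner x x = `|x| ^+ 2
}.

#[short(type="hilbertType")]
HB.structure Definition Hilbert (R : realType) :=
  {H of CompleteNormedModule R[i] H & CompleteNormedModule_isHilbert R H}.

Section Subspaces.
Variables (R : realType) (H : hilbertType R).
Implicit Types V W : set H.

Definition ominus V W : set H :=
  [set x | V x /\ forall y, W y -> inner x y = 0].

Definition has_dim V (n : nat) :=
  exists e : 'I_n -> H,
    (forall c : 'I_n -> R[i], \sum_i c i *: e i = 0 -> forall i, c i = 0) /\
    V = [set x | exists c : 'I_n -> R[i], x = \sum_i c i *: e i].

End Subspaces.

Section BoundedOperators.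
Variables (R : realType) (H : hilbertType R).

Definition is_bounded_operator : {pred H -> H} :=
  fun f => `[< linear f /\ continuous f >].

Record bounded_operator := BoundedOperator {
  bop_fun :> H -> H ;
  _ : bop_fun \in is_bounded_operator
}.

HB.instance Definition _ := [isSub for bop_fun].
HB.instance Definition _ := [Choice of bounded_operator by <:].

Lemma bounded_operator_submod : GRing.submod_closed is_bounded_operator.
Proof.
split=> [|a f g /asboolP[lf cf] /asboolP[lg cg]].
  apply/asboolP; split=> [a x y|x]; first by rewrite /= scaler0 addr0.
  exact: (@cst_continuous H H 0).
apply/asboolP; split=> [b x y|x].
  rewrite !fctE lf lg /= !scalerDr !scalerA (mulrC a b).
  by rewrite [RHS]addrACA.
by apply: cvgD; [apply: cvgZl_tmp; exact: cf|exact: cg].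
Qed.

HB.instance Definition _ :=
  GRing.isSubmodClosed.Build _ _ is_bounded_operator bounded_operator_submod.
HB.instance Definition _ := [SubChoice_isSubLmodule of bounded_operator by <:].

Implicit Types S T : bounded_operator.

Lemma bop_linear T : linear T.
Proof. by case: T => f /= /asboolP[]. Qed.

Lemma bop_continuous T : continuous T.
Proof. by case: T => f /= /asboolP[]. Qed.

HB.instance Definition _ T :=
  GRing.isLinear.Build _ _ _ _ (T : H -> H) (bop_linear T).

Lemma bopP S T : (forall x, S x = T x) <-> S = T.
Proof.
by split=> [ST|->//]; apply: val_inj; apply/funext => x; exact: ST.
Qed.

Lemma bop_one_subproof : id \in is_bounded_operator.
Proof. by apply/asboolP; split=> // x; exact: cvg_id. Qed.

Definition bop_one := BoundedOperator bop_one_subproof.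

Lemma bop_mul_subproof S T : S \o T \in is_bounded_operator.
Proof.
apply/asboolP; split=> [a x y|x] /=; first by rewrite !linearP.
by apply: continuous_comp; exact: bop_continuous.
Qed.

Definition bop_mul S T := BoundedOperator (bop_mul_subproof S T).

(* Norms of vectors are elements of R[i]: their real parts are taken in order
   to form a supremum in R. *)
Definition opnorm T : R[i] :=
  (sup [set complex.Re `|T x| | x in [set x : H | `|x| <= 1]])%:C.

Lemma normCRe (x : H) : `|x| = (complex.Re `|x|)%:C.
Proof. by rewrite RRe_real// ger0_real. Qed.

Lemma opnorm_has_sup T :
  has_sup [set complex.Re `|T x| | x in [set x : H | `|x| <= 1]].
Proof.
split; first by exists (complex.Re `|T 0|), 0 => //=; rewrite normr0.
have /linear_bounded_continuous/bounded_funP/(_ 1)[M TM] := @bop_continuous T.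
exists (complex.Re M) => _ [x /= x1 <-].
by have := TM x x1; rewrite lecE => /andP[].
Qed.

Lemma opnorm_ge0 T : 0 <= opnorm T.
Proof.
rewrite lecR (@le_trans _ _ (complex.Re `|T 0|))//.
  by have := normr_ge0 (T 0); rewrite lecE => /andP[].
by apply: (ub_le_sup (proj2 (opnorm_has_sup T))); exists 0; rewrite //= normr0.
Qed.

Lemma opnorm_bound T x : `|T x| <= opnorm T * `|x|.
Proof.
have [->|x0] := eqVneq x 0; first by rewrite linear0 !normr0 mulr0.
rewrite -ler_pdivrMr ?normr_gt0//.
have -> : `|T x| / `|x| = `|T (`|x|^-1 *: x)|.
  by rewrite linearZ normrZ normfV normr_id mulrC.
rewrite normCRe lecR; apply: (ub_le_sup (proj2 (opnorm_has_sup T))).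
by exists (`|x|^-1 *: x) => //=; rewrite normfZV.
Qed.

Lemma opnorm_le T (M : R[i]) :
  (forall x, `|T x| <= M * `|x|) -> 0 <= M -> opnorm T <= M.
Proof.
move=> TM M0; have MR : M = (complex.Re M)%:C by rewrite RRe_real// ger0_real.
rewrite MR lecR; apply: ge_sup; first exact: (proj1 (opnorm_has_sup T)).
move=> _ [x /= x1 <-]; rewrite -lecR -MR -normCRe.
by rewrite (le_trans (TM x))// ler_piMr.
Qed.

Lemma opnormD S T : opnorm (S + T) <= opnorm S + opnorm T.
Proof.
apply: opnorm_le => [x|]; last by rewrite addr_ge0// opnorm_ge0.
by rewrite (le_trans (ler_normD _ _))// mulrDl lerD// opnorm_bound.
Qed.

Lemma opnormZ_le a T : opnorm (a *: T) <= `|a| * opnorm T.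
Proof.
apply: opnorm_le => [x|]; last by rewrite mulr_ge0// opnorm_ge0.
by rewrite normrZ -mulrA ler_wpM2l// opnorm_bound.
Qed.

Lemma opnorm_eq0 T : opnorm T = 0 -> T = 0.
Proof.
move=> T0; apply/bopP => x; apply/eqP; rewrite -normr_le0.
by rewrite (le_trans (opnorm_bound T x))// T0 mul0r.
Qed.

Lemma opnormZ a T : opnorm (a *: T) = `|a| * opnorm T.
Proof.
apply/le_anti; rewrite opnormZ_le/=.
have [->|a0] := eqVneq a 0; first by rewrite normr0 mul0r opnorm_ge0.
rewrite -ler_pdivlMl ?normr_gt0// -normfV.
rewrite -[X in opnorm X <= _]scale1r -(mulVf a0) -scalerA.
exact: opnormZ_le.
Qed.

HB.instance Definition _ := Lmodule_isNormed.Build R[i] bounded_operator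
  opnormD opnormZ opnorm_eq0.

Lemma bop_normE T : `|T| = opnorm T. Proof. by []. Qed.

Lemma ler_norm_bop T x : `|T x| <= `|T| * `|x|.
Proof. exact: opnorm_bound. Qed.

Lemma bop_norm_le T (M : R[i]) :
  (forall x, `|T x| <= M * `|x|) -> 0 <= M -> `|T| <= M.
Proof. exact: opnorm_le. Qed.

Lemma bop_eval_continuous (x : H) : continuous (fun T : bounded_operator => T x).
Proof.
move=> T; apply/(@cvgrPdist_lt _ _ _ (nbhs T)) => e e0; near=> S.
have -> : T x - S x = (T - S) x by [].
rewrite (le_lt_trans (ler_norm_bop _ _))//.
rewrite (@le_lt_trans _ _ (`|T - S| * (`|x| + 1)))//.
  by rewrite ler_wpM2l// lerDl.
rewrite -ltr_pdivlMr ?ltr_wpDl//.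
near: S; apply: (@cvgr_dist_lt _ bounded_operator _ (nbhs T) _ id T cvg_id).
by rewrite divr_gt0// ltr_wpDl.
Unshelve. all: by end_near. Qed.

Lemma bop_cauchy_cvg (F : set_system bounded_operator) :
  ProperFilter F -> cauchy F -> cvg F.
Proof.
move=> FF /cauchyP Fc.
have {}Fc e : 0 < e -> exists T, \forall S \near F, `|T - S| < e.
  by move=> /Fc[T]; rewrite -ball_normE => FT; exists T.
have Ec x : cvg ((fun T : bounded_operator => T x) @ F).
  apply: cauchy_cvg; apply/cauchyP => e e0.
  have d0 : 0 < `|x| + 1 by rewrite ltr_wpDl.
  have [T FT] := Fc _ (divr_gt0 e0 d0).
  exists (T x); rewrite -ball_normE /nbhs/=; near=> S.
  rewrite /= -[T x - S x]/((T - S) x) (le_lt_trans (ler_norm_bop _ _))//.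
  rewrite (@le_lt_trans _ _ (`|T - S| * (`|x| + 1)))//.
    by rewrite ler_wpM2l// lerDl.
  by rewrite -ltr_pdivlMr//; near: S.
pose L x := lim ((fun T : bounded_operator => T x) @ F).
have cL x : (fun T : bounded_operator => T x) @ F --> L x by exact: Ec.
have Llin : linear L.
  move=> a x y; apply: cvg_lim; first exact: norm_hausdorff.
  have -> : (fun T : bounded_operator => T (a *: x + y)) =
            (fun T : bounded_operator => a *: T x + T y).
    by apply/funext => T; rewrite linearP.
  by apply: cvgD => //; apply: cvgZl_tmp.
pose LL : {linear H -> H} := HB.pack L (GRing.isLinear.Build _ _ _ _ L Llin).
have L0 : L 0 = 0 by exact: (linear0 LL).
have LC e : 0 < e -> \forall S \near F, forall x, `|(S : bounded_operator) x - L x| <= e * `|x|.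
  move=> e0; have e40 : 0 < e / 2 / 2 by rewrite !divr_gt0.
  have [T FT] := Fc _ e40.
  near=> S => x; have [->|x0] := eqVneq x 0.
    by rewrite L0 linear0 subrr normr0 mulr0.
  have nx0 : 0 < `|x| by rewrite normr_gt0.
  have : \forall S' \near F, `|T - S'| < e / 2 / 2 /\ `|L x - S' x| < e / 2 * `|x|.
    near=> S'; split; first by near: S'.
    near: S'; apply: (@cvgr_dist_lt _ H _ F _ (fun T : bounded_operator => T x) (L x) (cL x)).
    by rewrite mulr_gt0// divr_gt0.
  move=> /filter_ex[S' [TS' LS']].
  have -> : S x - L x = (S - S') x + (S' x - L x).
    by rewrite -[(S - S') x]/(S x - S' x) addrA subrK.
  rewrite (le_trans (ler_normD _ _))// [leRHS](_ : _ = e / 2 * `|x| + e / 2 * `|x|).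
    2: by rewrite -mulrDl -splitr.
  rewrite lerD//; last by rewrite distrC ltW.
  rewrite (le_trans (ler_norm_bop _ _))// ler_wpM2r//.
  have -> : S - S' = (T - S') - (T - S).
    by rewrite opprB [RHS]addrC addrA subrK.
  rewrite (le_trans (ler_normB _ _))//.
  rewrite [leRHS]splitr lerD// ltW//; last by near: S.
have Lcont : continuous LL.
  apply: bounded_linear_continuous; apply/linear_boundedP.
  have /filter_ex[S SL] := LC 1 ltr01.
  near=> r => x; rewrite -[LL x]/(L x).
  have -> : L x = S x - (S x - L x) by rewrite opprB [RHS]addrC subrK.
  rewrite (le_trans (ler_normB _ _))// (le_trans (lerD (ler_norm_bop _ _) (SL x)))//.
  rewrite -mulrDl; apply: ler_wpM2r; first exact: normr_ge0.
  near: r.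
  by apply: nbhs_pinfty_ge; exact: (realD (normr_real _) (real1 _)).
have LB : L \in is_bounded_operator by apply/asboolP; split.
apply/cvg_ex; exists (BoundedOperator LB); apply/cvgrPdist_le => e e0.
near=> S; apply: bop_norm_le; last exact: ltW.
move=> x; rewrite -[(_ - S) x]/(L x - S x) distrC.
by move: x; near: S; exact: LC.
Unshelve. all: by end_near. Qed.

HB.instance Definition _ :=
  Uniform_isComplete.Build bounded_operator bop_cauchy_cvg.

Lemma bop_norm_mul S T : `|bop_mul S T| <= `|S| * `|T|.
Proof.
apply: bop_norm_le => [x|]; last by rewrite mulr_ge0.
by rewrite (le_trans (ler_norm_bop S (T x)))// -mulrA ler_wpM2l// ler_norm_bop.
Qed.

End BoundedOperators.

Section Nests.
Variables (R : realType) (H : hilbertType R).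

Record omega_nest := OmegaNest {
  nest_space :> nat -> set H ;
  nest_submod : forall k, GRing.submod_closed [in nest_space k] ;
  nest_closed : forall k, closed (nest_space k) ;
  nest0 : nest_space 0 = [set 0] ;
  nest_lt : forall k, nest_space k `<` nest_space k.+1 ;
  nest_dense : dense (\bigcup_k nest_space k)
}.

Variable N : omega_nest.

Definition nest_family : set (set H) := range N `|` [set setT].

(* atom k is meaningful for k >= 1 only. *)
Definition atom (k : nat) : set H := ominus (N k) (N k.-1).

Definition in_nest_algebra : {pred bounded_operator H} :=
  fun T => `[< forall V, nest_family V -> T @` V `<=` V >].

Record nest_algebra := NestAlgebra {
  nest_op :> bounded_operator H ;
  _ : nest_op \in in_nest_algebra
}.

HB.instance Definition _ := [isSub for nest_op].
HB.instance Definition _ := [Choice of nest_algebra by <:].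

Lemma in_nest_algebraP (T : bounded_operator H) :
  T \in in_nest_algebra <-> forall k x, N k x -> N k (T x).
Proof.
split=> [/asboolP TN k x Nx|TN]; first by apply: (TN (N k)); [left; exists k|exists x].
by apply/asboolP => _ [[k _ <-]|->] // _ [x Nx <-]; exact: TN.
Qed.

Lemma nest_algebra_submod : GRing.submod_closed in_nest_algebra.
Proof.
split=> [|a S T /in_nest_algebraP SN /in_nest_algebraP TN];
  apply/in_nest_algebraP => k x Nx.
  by have [/[!inE] N0 _] := nest_submod N k.
have [_ NZ] := nest_submod N k.
have := NZ a (S x) (T x); rewrite !inE; apply; [exact: SN|exact: TN].
Qed.

HB.instance Definition _ := GRing.isSubmodClosed.Build _ _ in_nest_algebra
  nest_algebra_submod.
HB.instance Definition _ := [SubChoice_isSubLmodule of nest_algebra by <:].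

Implicit Types S T : nest_algebra.

Lemma nest_stable T k x : N k x -> N k (T x).
Proof. by move: k x; apply/in_nest_algebraP; case: T. Qed.

Definition nest_norm T : R[i] := `|nest_op T|.

Lemma nest_normD S T : nest_norm (S + T) <= nest_norm S + nest_norm T.
Proof. exact: ler_normD. Qed.

Lemma nest_normZ a T : nest_norm (a *: T) = `|a| * nest_norm T.
Proof. exact: normrZ. Qed.

Lemma nest_norm_eq0 T : nest_norm T = 0 -> T = 0.
Proof. by move=> /normr0_eq0 T0; exact: val_inj. Qed.

HB.instance Definition _ := Lmodule_isNormed.Build R[i] nest_algebra
  nest_normD nest_normZ nest_norm_eq0.

Lemma nest_normE T : `|T| = `|nest_op T|. Proof. by []. Qed.

Lemma nest_cauchy_cvg (F : set_system nest_algebra) :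
  ProperFilter F -> cauchy F -> cvg F.
Proof.
move=> FF /cauchyP Fc.
have : cvg (nest_op @ F).
  apply: cauchy_cvg; apply/cauchyP => e /Fc[T FT].
  by exists (nest_op T); move: FT; rewrite -!ball_normE.
move=> /cvg_ex[L FL].
have LN : L \in in_nest_algebra.
  apply/in_nest_algebraP => k x Nx.
  apply: (@closed_cvg _ _ F _ (fun T : nest_algebra => T x) _ (nest_closed (k:=k))).
    by apply: nearW => T; exact: nest_stable.
  exact: (cvg_comp _ _ FL (@bop_eval_continuous _ _ x L)).
apply/cvg_ex; exists (NestAlgebra LN); apply/cvgrPdist_lt => e e0.
have /cvgrPdist_lt/(_ e e0) := FL.
exact.
Unshelve. all: by end_near. Qed.

HB.instance Definition _ :=
  Uniform_isComplete.Build nest_algebra nest_cauchy_cvg.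

Lemma nest_one_subproof : bop_one H \in in_nest_algebra.
Proof. exact/in_nest_algebraP. Qed.

Definition nest_one := NestAlgebra nest_one_subproof.

Lemma nest_mul_subproof S T : bop_mul S T \in in_nest_algebra.
Proof.
by apply/in_nest_algebraP => k x Nx /=; do 2!apply: nest_stable.
Qed.

Definition nest_mul S T := NestAlgebra (nest_mul_subproof S T).

Lemma nest_algP S T : (forall x, S x = T x) <-> S = T.
Proof. by split=> [ST|->//]; apply/val_inj/bopP. Qed.

Lemma nest_mulA : associative nest_mul.
Proof. by move=> S T U; exact/nest_algP. Qed.

Lemma nest_mul1 : right_id nest_one nest_mul.
Proof. by move=> S; exact/nest_algP. Qed.

Lemma nest_1mul : left_id nest_one nest_mul.
Proof. by move=> S; exact/nest_algP. Qed.

Lemma nest_mul_linearl T : linear (nest_mul ^~ T).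
Proof. by move=> a S S'; exact/nest_algP. Qed.

Lemma nest_mul_linearr S : linear (nest_mul S).
Proof. by move=> a T T'; apply/nest_algP => x; exact: linearP. Qed.

Lemma nest_norm_mul S T : `|nest_mul S T| <= `|S| * `|T|.
Proof. exact: bop_norm_mul. Qed.

Lemma nest_norm_one : `|nest_one| = 1.
Proof.
apply/le_anti/andP; split.
  by apply: bop_norm_le => // x; rewrite mul1r.
have [x x0] : exists x : H, x != 0.
  have [_ /existsNP[x /not_implyP[_ x0]]] := nest_lt N 0.
  by exists x; apply/eqP => x00; apply: x0; rewrite nest0.
have := ler_norm_bop (bop_one H) x.
by rewrite /= -[leLHS]mul1r ler_pM2r// normr_gt0.
Qed.

HB.instance Definition _ := isBanachAlgebra.Build R[i] nest_algebra
  nest_mulA nest_mul1 nest_1mul nest_mul_linearl nest_mul_linearr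
  nest_norm_mul nest_norm_one.

End Nests.

(* Main.v *)
(* Write s_k = n_1 + ... + n_k.  The sequence n is deep if, for every ratio rho
   and every length t, there are t + 1 consecutive intervals of atoms in which
   each interval has at least rho times the total dimension of the next one.
   This is invariant under c n_k <= m_k <= d n_k, and it decides the rank: it is
   infinite if n is deep and 2 otherwise.

   If n is deep, let the row A map the p copies of each interval isometrically
   into the preceding one.  If A' is close to A and A' B = 1, a unit vector e of
   the last interval gives x = B e whose components must grow geometrically from
   each interval to the preceding one, because the triangular perturbation
   A' - A has to cancel the isometric image; long chains contradict |x| <= |B|.
   The same estimate for a shift excludes rows of length 1.

   If n is not deep, call an atom j < k dominating when n_j is at least M times
   the total dimension of the atoms j + 1, ..., k, and let the parent of k be the
   last dominating atom.  Chains of ancestors are then bounded, the descendants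
   of j have total dimension at most n_j / 2, and the atoms between k and its
   parent have total dimension at most C n_k.  Distribute the basis vectors over
   the residue classes modulo r = 2 C and solve A B = 1 one class at a time.  For
   a basis vector in atom k, a dimension count inside the two copies of k and of
   each of its ancestors gives a unit vector whose image has no entries of the
   current class between that atom and its parent; the image of each of these
   vectors is cancelled by a small perturbation of the value of A on the vector
   chosen at the next ancestor, so that the errors telescope and vanish at the
   root. *)
Require Import Defs.
From HB Require Import structures.
From mathcomp Require Import all_boot all_order all_algebra.
From mathcomp Require Import all_classical all_reals all_analysis.
From mathcomp Require Import complex zify ring.
Import Order.TTheory GRing.Theory Num.Def Num.Theory.
Import numFieldNormedType.Exports.

Set Implicit Arguments.
Unset Strict Implicit.
Unset Printing Implicit Defensive.

(** * Dimension sequences *)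

Section Combinatorics.
Implicit Types (n m : nat -> nat).

(* Atoms are numbered from 1: n 0 is never used, and partial_dim n k = dim N_k. *)
Definition partial_dim (n : nat -> nat) k := (\sum_(j < k) n j.+1)%N.

Lemma partial_dimS n k : partial_dim n k.+1 = (partial_dim n k + n k.+1)%N.
Proof. by rewrite /partial_dim big_ord_recr. Qed.

Lemma partial_dim_le n : {homo partial_dim n : k l / (k <= l)%N}.
Proof.
move=> k l; elim: l => [|l IH]; first by rewrite leqn0 => /eqP ->.
rewrite leq_eqVlt => /predU1P[->//|]; rewrite ltnS => /IH /leq_trans; apply.
by rewrite partial_dimS leq_addr.
Qed.

Lemma partial_dim_block n a k : (a < partial_dim n k)%N ->
  exists j i, [/\ (j < k)%N, (i < n j.+1)%N & a = (partial_dim n j + i)%N].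
Proof.
elim: k => [|k IH]; first by rewrite /partial_dim big_ord0.
have [/IH[j [i [jk iN ->]]] _|ka] := ltnP a (partial_dim n k).
  by exists j, i; split=> //; exact: ltnW.
rewrite partial_dimS => ak; exists k, (a - partial_dim n k)%N; split=> //.
  by rewrite ltn_subLR.
by rewrite subnKC.
Qed.

Lemma partial_dim_inj n j i k l :
  (i < n j.+1)%N -> (l < n k.+1)%N -> (partial_dim n j + i = partial_dim n k + l)%N ->
  j = k /\ i = l.
Proof.
move=> ij lk; have [jk|kj|->] := ltngtP j k; last by move=> /addnI ->.
- move=> E; suff : (partial_dim n j + i < partial_dim n k + l)%N by rewrite E ltnn.
  rewrite ltn_addr// (@leq_trans (partial_dim n j.+1))// ?partial_dim_le//.
  by rewrite partial_dimS ltn_add2l.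
- move=> E; suff : (partial_dim n k + l < partial_dim n j + i)%N by rewrite E ltnn.
  rewrite ltn_addr// (@leq_trans (partial_dim n k.+1))// ?partial_dim_le//.
  by rewrite partial_dimS ltn_add2l.
Qed.

(** The value is also 0 when [P] fails up to [j], so only a positive value guarantees [P]. *)
Fixpoint last_below (P : pred nat) j :=
  if P j then j else if j is i.+1 then last_below P i else 0.

Lemma last_below_le P j : last_below P j <= j.
Proof. by elim: j => [|j IH] /=; case: ifP => // _; apply: leq_trans IH _. Qed.

Lemma last_below_gt P j l : last_below P j < l <= j -> ~~ P l.
Proof.
elim: j l => [|j IH] l /=; case: ifP => //; try lia.
move=> Pj /andP[jl]; rewrite leq_eqVlt => /predU1P[->|lj]; first by rewrite Pj.
by apply: IH; rewrite jl.
Qed.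

Lemma last_below_P (P : pred nat) j i : i <= j -> P i -> P (last_below P j) /\ i <= last_below P j.
Proof.
elim: j => [|j IH] /=; first by rewrite leqn0 => /eqP -> P0; rewrite P0.
case: ifP => [//|Pj]; rewrite leq_eqVlt => /predU1P[->|]; first by rewrite Pj.
exact: IH.
Qed.

Lemma last_below_neq0 (P : pred nat) j : 0 < last_below P j -> P (last_below P j).
Proof. by elim: j => [|j IH] /=; case: ifP. Qed.

(* The i-th interval consists of the atoms kappa i + 1, ..., kappa i.+1. *)
Definition geometric_chain n rho t (kappa : nat -> nat) :=
  (forall i, i <= t -> kappa i < kappa i.+1) /\
  (forall i, i < t ->
    rho * (partial_dim n (kappa i.+2) - partial_dim n (kappa i.+1)) <=
    partial_dim n (kappa i.+1) - partial_dim n (kappa i)).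

Definition deep n := forall rho t, exists kappa, geometric_chain n rho t kappa.

Lemma partial_dimB n q m a b : (forall k, n k.+1 <= q * m k.+1) -> a <= b ->
  partial_dim n b - partial_dim n a <= q * (partial_dim m b - partial_dim m a).
Proof.
move=> nm; elim: b => [|b IH]; first by rewrite leqn0 => /eqP ->; lia.
rewrite leq_eqVlt => /predU1P[->|]; first by lia.
rewrite ltnS => ab; have := IH ab; have := nm b; rewrite !partial_dimS.
have := partial_dim_le n ab; have := partial_dim_le m ab; nia.
Qed.

(** The same chain serves [m]: each of the two compared dimensions changes by a factor at most
    [q.+1], so ratio [rho * q.+1 ^ 2] is asked of [n]. The successor keeps the factor
    cancellable. *)
Lemma deep_equiv n m q :
  (forall k, n k.+1 <= q * m k.+1) -> (forall k, m k.+1 <= q * n k.+1) ->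
  deep n -> deep m.
Proof.
move=> nm mn dn rho t; have [k [kk kn]] := dn (rho * q.+1 ^ 2) t.
exists k; split=> // i it.
have nm' j : n j.+1 <= q.+1 * m j.+1 by have := nm j; nia.
have mn' j : m j.+1 <= q.+1 * n j.+1 by have := mn j; nia.
have := kn i it.
have := partial_dimB nm' (ltnW (kk i (ltnW it))).
have := partial_dimB mn' (ltnW (kk i.+1 it)).
set a := _ - _; set b := _ - _; set c := _ - _; set d := _ - _ => h1 h2 h3.
rewrite -(@leq_pmul2l q.+1)// (leq_trans _ h2)// (leq_trans _ h3)//.
by rewrite expnS expn1 -!mulnA mulnCA leq_mul2l; apply/orP; right; rewrite leq_mul2l h1 orbT.
Qed.

(** Drop the first [k0] intervals of a longer chain; strict growth has moved it past [k0]. This lets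
    chains of all lengths be laid out one after the other. *)
Lemma deep_after n t rho k0 : deep n ->
  exists kappa, geometric_chain n rho t kappa /\ k0 <= kappa 0.
Proof.
move=> /(_ rho (t + k0))[k [kk kn]].
have ki i : i <= (t + k0).+1 -> i <= k i.
  by elim: i => // i IH it; have := kk i it; have := IH (ltnW it); lia.
exists (fun i => k (k0 + i)); split; last first.
  by rewrite addn0; apply: ki; lia.
by split=> i it; rewrite !addnS; [apply: kk|apply: kn]; lia.
Qed.

(** * The tree of dominating atoms of a shallow sequence *)

Section Tree.
Variables (n : nat -> nat) (rho t : nat).
Hypothesis n_gt0 : forall k, 0 < n k.+1.
Hypothesis shallow : forall kappa, ~ geometric_chain n rho t kappa.
Let s := partial_dim n.
Let M := rho + 3.

Definition dominating k j := M * (s k - s j) <= n j.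
(* The value 0 means that k has no dominating atom. *)
Definition parent k := if k is l.+1 then last_below (dominating k) l else 0.

Lemma partial_dim_lt k l : k < l -> s k < s l.
Proof.
move=> kl; apply: (@leq_trans (s k.+1)); last exact: partial_dim_le.
by rewrite /s partial_dimS -[ltnLHS]addn0 ltn_add2l n_gt0.
Qed.

Lemma parent_lt k : 0 < k -> parent k < k.
Proof. by case: k => // k _; rewrite /= ltnS last_below_le. Qed.

Lemma parent_dom k : 0 < parent k -> dominating k (parent k).
Proof. by case: k => // k; exact: last_below_neq0. Qed.

Lemma parent_iter_le i k : iter i parent k <= k.
Proof.
elim: i => //= i IH; apply: leq_trans IH.
by case: (iter i parent k) => // l; apply: ltnW; exact: parent_lt.
Qed.

(** Weakening [M] to [M - 1] pays for all generations at once: at the step from [j] to its parent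
    [q], induction gives [(M - 1) * (s k - s j) <= n j <= s j - s q], which the spare copy of
    [s j - s q] absorbs. *)
Lemma iter_parent_dom i k : 0 < iter i.+1 parent k ->
  (M - 1) * (s k - s (iter i.+1 parent k)) <= n (iter i.+1 parent k).
Proof.
elim: i => [|i IH]; first by move=> /parent_dom; rewrite /dominating /=; nia.
rewrite [iter i.+2 _ _]iterS; set j := iter i.+1 _ _ in IH *; set q := parent j => q0.
have j0 : 0 < j by move: q0; rewrite /q; case: (j).
have qj : q < j by exact: parent_lt.
have jk : j <= k by exact: parent_iter_le.
have := parent_dom q0; rewrite -/q /dominating => Mq.
have nj : n j <= s j - s q.
  case: (j) j0 qj => // l _ ql.
  have {}ql : q <= l by [].
  by have := partial_dim_le n ql; rewrite /s partial_dimS; lia.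
have := IH j0; have := partial_dim_le n jk; have := partial_dim_lt qj; rewrite -/s /M in Mq *.
nia.
Qed.

Lemma parent_depth k : iter t.+2 parent k = 0.
Proof.
apply/eqP; rewrite eqn0Ngt; apply/negP => pk.
have p0 i : i <= t.+2 -> 0 < iter i parent k.
  move=> it; rewrite lt0n; apply/negP => /eqP i0; move: pk.
  rewrite -(subnK it) iterD i0 lt0n => /negP; apply; rewrite -leqn0.
  exact: parent_iter_le.
(* The ancestors are listed from the oldest on. The predecessor makes each one the first atom of its
   interval, and for the chain inequality that atom alone is large enough. *)
apply: (@shallow (fun i => (iter (t.+1 - i) parent k).-1)); split=> i it.
  have -> : t.+1 - i = (t.+1 - i.+1).+1 by lia.
  have := p0 (t.+1 - i.+1).+1; rewrite /=.
  have := p0 (t.+1 - i.+1).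
  have := @parent_lt (iter (t.+1 - i.+1) parent k); lia.
have -> : t.+1 - i = (t.+1 - i.+2).+2 by lia.
have -> : t.+1 - i.+1 = (t.+1 - i.+2).+1 by lia.
set d := t.+1 - i.+2.
have d2 : d.+2 <= t.+2 by rewrite /d; lia.
have {}p0 : 0 < iter d.+2 parent k by exact: p0.
set k0 := iter d parent k.
have k2E : iter d.+2 parent k = iter 2 parent k0 by [].
have k1E : iter d.+1 parent k = parent k0 by [].
rewrite k2E k1E in p0 *.
have := iter_parent_dom p0.
set k2 := iter 2 parent k0 in p0 *; set k1 := parent k0.
have k10 : 0 < k1 by move: p0; rewrite /k2/= -/k1; case: (k1).
have k00 : 0 < k0 by move: k10; rewrite /k1; case: (k0).
have k21 : k2 < k1 := parent_lt k10.
have k1k0 : k1 < k0 := parent_lt k00.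
have n2 : n k2 + s k2.-1 = s k2.
  by case: (k2) p0 => // l _; rewrite /s partial_dimS addnC.
have s21 : s k2 <= s k1.-1 by apply: partial_dim_le; lia.
have s10 : s k1.-1 <= s k0.-1 by apply: partial_dim_le; lia.
have s00 : s k0.-1 <= s k0 by apply: partial_dim_le; lia.
rewrite -/s => dom.
rewrite (@leq_trans (n k2))//; last by lia.
rewrite (leq_trans _ dom)//; apply: leq_mul; rewrite /M; lia.
Qed.

Definition zone_const := ((rho + 1) * (M + 1)) ^ t.+2.

(** Walk down from [k] through cuts at which the dimension up to [k] grows by a factor between
    [rho + 1] and [G]. If the zone were larger than claimed, enough cuts would fit above the parent
    to form a forbidden chain. *)
Lemma parent_zone k : 0 < k -> s k - s (parent k) <= zone_const * n k.
Proof.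
case: k => // k _; set K := k.+1; rewrite leqNgt; apply/negP => big.
pose v j := s K - s j.
(* The factor is [rho + 1] because the interval between two cuts has dimension [v (next b) - v b],
   which must still be at least [rho * v b]. *)
pose next b := last_below (fun j => (rho + 1) * v b <= v j) b.-1.
pose G := (rho + 1) * (M + 1).
have pK : parent K < K by exact: parent_lt.
have vk : v k = n K by rewrite /v /K /s partial_dimS addKn.
(* No atom strictly between the parent and [K] is dominating, so atom [j] adds at most [M * v j]. *)
have vS j : parent K < j < K -> v j.-1 <= (M + 1) * v j.
  case: j => // j /andP[pj jK].
  have /= : ~~ dominating K j.+1.
    by apply: (@last_below_gt _ k); rewrite pj -ltnS.
  have : s j.+1 <= s K by apply: partial_dim_le; exact: ltnW.
  rewrite /dominating /v /s !partial_dimS -/s; nia.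
have inv i : i <= t.+1 -> [/\ parent K < iter i next k < K & v (iter i next k) <= G ^ i * n K] ->
    [/\ next (iter i next k) < iter i next k,
     parent K <= next (iter i next k),
     (rho + 1) * v (iter i next k) <= v (next (iter i next k)) &
     v (next (iter i next k)) <= G ^ i.+1 * n K].
  move=> it; set b := iter i next k => -[/andP[pb bK] vb].
  have big' : (rho + 1) * v b <= v (parent K).
    rewrite (leq_trans _ (ltnW big))//.
    rewrite (@leq_trans ((rho + 1) * (G ^ i * n K)))//.
      by rewrite leq_mul2l vb orbT.
    rewrite mulnA leq_mul2r; apply/orP; right.
    rewrite (@leq_trans (G ^ i.+1))//.
      by rewrite expnS leq_mul2r /G leq_pmulr ?orbT// /M; lia.
    by rewrite /zone_const -/G leq_pexp2l// /G /M; nia.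
  have [Pn pn] := @last_below_P (fun j => (rho + 1) * v b <= v j) b.-1 (parent K) ltac:(lia) big'.
  have nb : next b <= b.-1 by exact: last_below_le.
  split=> //; first by lia.
  (* One atom above the new cut, [v] is still small by maximality of [next b]; [vS] then gives the
     factor [G]. *)
  have nS : v (next b).+1 <= (rho + 1) * v b.
    have [bn|nb'] := leqP b (next b).+1.
      have -> : (next b).+1 = b by lia.
      by nia.
    have := @last_below_gt (fun j => (rho + 1) * v b <= v j) b.-1 (next b).+1.
    rewrite -/(next b) => /(_ ltac:(lia)); lia.
  have := vS (next b).+1 ltac:(rewrite /next in pn nb *; lia) => /= vn.
  rewrite (leq_trans vn)// expnS -mulnA (@leq_trans ((M + 1) * ((rho + 1) * v b)))//.
    by rewrite leq_mul2l nS orbT.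
  by rewrite mulnA (mulnC (M + 1)) -/G leq_mul2l vb orbT.
have pos i : i <= t.+2 -> parent K < iter i next k < K /\ v (iter i next k) <= G ^ i * n K.
  have strict j b : j <= t.+2 -> parent K <= b -> v b <= G ^ j * n K -> parent K < b.
    move=> jt; rewrite leq_eqVlt => /predU1P[<- vb|//]; exfalso.
    move: big; rewrite ltnNge => /negP; apply; rewrite (leq_trans vb)// leq_mul2r.
    by rewrite /zone_const -/G leq_pexp2l ?orbT// /G /M; nia.
  elim: i => [_|i IH it].
    have vk' : v k <= G ^ 0 * n K by rewrite expn0 mul1n vk.
    by split=> //; rewrite ltnSn andbT; exact: strict vk'.
  have [/andP[pb bK] vb] := IH (ltnW it).
  have [|nb pn _ vn] := inv i it; first by rewrite pb bK.
  split; last by rewrite iterS.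
  by rewrite iterS (strict i.+1)//= (ltn_trans nb).
apply: (@shallow (fun i => iter (t.+1 - i) next k)); split=> i it.
  have -> : t.+1 - i = (t.+1 - i.+1).+1 by lia.
  have it' : t.+1 - i.+1 <= t.+1 by lia.
  by have [|nb _ _ _] := inv _ it'; first exact: pos (leqW it').
have -> : t.+1 - i = (t.+1 - i.+2).+2 by lia.
have -> : t.+1 - i.+1 = (t.+1 - i.+2).+1 by lia.
set d := t.+1 - i.+2.
have d1 : d.+1 <= t.+1 by rewrite /d; lia.
have pd := pos d (leqW (ltnW d1)).
have pd1 := pos d.+1 (leqW d1).
have [n0 _ _ _] := inv d (ltnW d1) pd.
have [n1 _ v1 _] := inv d.+1 d1 pd1.
rewrite !iterS in n1 v1 pd1 *; move: n0 n1 v1; rewrite -/s.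
set b0 := iter d next k in pd pd1 *; set b1 := next b0 in pd1 *; set b2 := next b1 => n0 n1 v1.
have sb0 : s b0 <= s K by apply: partial_dim_le; case: pd => /andP[_ /ltnW].
have sb1 : s b1 <= s b0 by apply: partial_dim_le; exact: ltnW.
have sb2 : s b2 <= s b1 by apply: partial_dim_le; exact: ltnW.
move: v1; rewrite /v => v1.
rewrite (@leq_trans (rho * (s K - s b1)))//; last by nia.
by rewrite leq_mul2l leq_sub2r ?orbT.
Qed.

End Tree.

End Combinatorics.

(** * Blocks of basis indices and residue classes *)

Section Blocks.
Variable n : nat -> nat.
Hypothesis n_gt0 : forall k, (0 < n k.+1)%N.
Let s := partial_dim n.

Lemma partial_dim_mono : {mono s : k l / (k <= l)%N}.
Proof. by apply: leq_mono => k l; exact: partial_dim_lt. Qed.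

Lemma partial_dim_mono_lt : {mono s : k l / (k < l)%N}.
Proof. exact: leqW_mono partial_dim_mono. Qed.

Lemma partial_dim_ge k : (k <= s k)%N.
Proof.
by elim: k => // k /leq_ltn_trans; apply; rewrite partial_dim_mono_lt.
Qed.

(* The b-th basis vector belongs to atom block b + 1. *)
Definition block b := last_below (fun k => (s k <= b)%N) b.

Lemma blockP b k : (block b == k) = (s k <= b < s k.+1)%N.
Proof.
have [sb _] : (s (block b) <= b)%N /\ (0 <= block b)%N.
  by apply: last_below_P => //; rewrite /s /partial_dim big_ord0.
have bs : (b < s (block b).+1)%N.
  rewrite ltnNge; apply/negP => sb'.
  have := @last_below_gt (fun k => (s k <= b)%N) b (block b).+1.
  rewrite ltnSn /= sb' => /(_ _)/negP; apply=> //.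
  exact: leq_trans (partial_dim_ge _) sb'.
apply/eqP/idP => [<-|/andP[kb bk]]; first by rewrite sb.
have := leq_ltn_trans sb bk; have := leq_ltn_trans kb bs.
by rewrite !partial_dim_mono_lt => k1 k2; apply/eqP; rewrite eqn_leq -ltnS k2 -ltnS.
Qed.

Lemma block_lt b k : (b < s k)%N = (block b < k)%N.
Proof.
have := eqxx (block b); rewrite blockP => /andP[sb bs].
apply/idP/idP => [bk|bk].
  by rewrite -partial_dim_mono_lt -/s; exact: leq_ltn_trans bk.
by apply: (leq_trans bs); rewrite partial_dim_mono.
Qed.

End Blocks.

Lemma count_residue_window r i m l : (l <= r)%N ->
  (count (fun c => c %% r == i) (iota m l) <= 1)%N.
Proof.
move=> lr; rewrite -size_filter leqNgt; apply/negP => big.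
set f := [seq c <- _ | _] in big.
have uf : uniq f by rewrite filter_uniq ?iota_uniq.
have f0 : nth 0%N f 0 \in f by rewrite mem_nth// ltnW.
have f1 : nth 0%N f 1 \in f by rewrite mem_nth.
have : nth 0%N f 0 <> nth 0%N f 1.
  by move/eqP; rewrite nth_uniq// ltnW.
move: f0 f1; rewrite !mem_filter !mem_iota => /andP[/eqP h0 b0] /andP[/eqP h1 b1]; apply.
move: h0 h1 b0 b1; set x := nth _ _ _; set y := nth _ _ _ => h0 h1 b0 b1.
have := divn_eq x r; have := divn_eq y r; rewrite h0 h1.
have [q|q|->] := ltngtP (x %/ r) (y %/ r); last by move=> ey ex; exact: etrans ex (esym ey).
- have : ((x %/ r).+1 * r <= y %/ r * r)%N by rewrite leq_mul2r q orbT.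
  by rewrite mulSn; lia.
- have : ((y %/ r).+1 * r <= x %/ r * r)%N by rewrite leq_mul2r q orbT.
  by rewrite mulSn; lia.
Qed.

(** Cut the range into at most [q] windows of length at most [r], each meeting the class at most
    once. *)
Lemma count_residue r i m l q : (l <= r * q)%N ->
  (count (fun c => c %% r == i) (iota m l) <= q)%N.
Proof.
elim: q m l => [|q IH] m l; first by rewrite muln0 leqn0 => /eqP ->.
move=> lrq; have [lr|rl] := leqP l r; first exact: leq_trans (count_residue_window i m lr) _.
rewrite -(subnKC (ltnW rl)) iotaD count_cat -add1n leq_add//.
  exact: count_residue_window.
by apply: IH; rewrite leq_subLR -mulnS.
Qed.

Local Open Scope ring_scope.

(** * Hilbert spaces *)

Section Hilbert.
Context {R : realType} {H : hilbertType R}.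
Implicit Types (x y z : H) (a : R[i]).

Lemma ipDl x y z : inner (x + y) z = inner x z + inner y z.
Proof. exact: linearDl. Qed.

Lemma ipDr x y z : inner z (x + y) = inner z x + inner z y.
Proof. exact: linearDr. Qed.

Lemma ipNl x z : inner (- x) z = - inner x z.
Proof. exact: linearNl. Qed.

Lemma ipNr x z : inner z (- x) = - inner z x.
Proof. exact: linearNr. Qed.

Lemma ipBl x y z : inner (x - y) z = inner x z - inner y z.
Proof. by rewrite ipDl ipNl. Qed.

Lemma ipBr x y z : inner z (x - y) = inner z x - inner z y.
Proof. by rewrite ipDr ipNr. Qed.

Lemma ipZl a x z : inner (a *: x) z = a * inner x z.
Proof. by rewrite linearZl_LR. Qed.

Lemma ipZr a x z : inner z (a *: x) = a^* * inner z x.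
Proof. by rewrite linearZr_LR. Qed.

Lemma ip0l z : inner 0 z = 0.
Proof. exact: linear0l. Qed.

Lemma ip0r z : inner z 0 = 0.
Proof. exact: linear0r. Qed.

Lemma ip_suml I (r : seq I) (P : pred I) (F : I -> H) z :
  inner (\sum_(i <- r | P i) F i) z = \sum_(i <- r | P i) inner (F i) z.
Proof. exact: linear_sumlz. Qed.

Lemma ip_sumr I (r : seq I) (P : pred I) (F : I -> H) z :
  inner z (\sum_(i <- r | P i) F i) = \sum_(i <- r | P i) inner z (F i).
Proof.
elim/big_rec2: _ => [|i u v _ <-]; first exact: ip0r.
exact: ipDr.
Qed.

Lemma ipC x y : inner x y = (inner y x)^*.
Proof. by rewrite [LHS]hermC expr0 mul1r. Qed.

Lemma ip_eq0C x y : inner x y = 0 -> inner y x = 0.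
Proof. by rewrite ipC => /eqP; rewrite conjC_eq0 => /eqP. Qed.

Lemma norm2D x y : inner x y = 0 -> `|x + y| ^+ 2 = `|x| ^+ 2 + `|y| ^+ 2.
Proof.
by move=> xy; rewrite -!inner_norm ipDl !ipDr xy (ip_eq0C xy) add0r addr0.
Qed.

Lemma norm1_ip x : inner x x = 1 -> `|x| = 1.
Proof.
rewrite inner_norm => /eqP; rewrite -subr_eq0 subr_sqr_1 mulf_eq0 => /orP[|].
  by rewrite subr_eq0 => /eqP.
by rewrite gt_eqF// ltr_wpDl.
Qed.

Lemma norm2_sum_orth (I : eqType) (r : seq I) (F : I -> H) :
  uniq r -> {in r &, forall i j, i != j -> inner (F i) (F j) = 0} ->
  `|\sum_(i <- r) F i| ^+ 2 = \sum_(i <- r) `|F i| ^+ 2.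
Proof.
elim: r => [|i r IH] /=; first by rewrite !big_nil normr0 expr0n.
move=> /andP[ir ur] o; rewrite !big_cons norm2D ?IH//.
  by move=> j k jr kr; apply: o; rewrite inE ?jr ?kr orbT.
rewrite ip_sumr big_seq big1// => j jr; apply: o; rewrite ?inE ?eqxx ?jr ?orbT//.
by apply: contra ir => /eqP ->.
Qed.

Lemma cauchy_schwarz x y : `|inner x y| <= `|x| * `|y|.
Proof.
have [->|y0] := eqVneq y 0; first by rewrite ip0r !normr0 mulr0.
have ny : 0 < `|y| by rewrite normr_gt0.
have ny2 : `|y| ^+ 2 != 0 by rewrite expf_neq0// gt_eqF.
rewrite -(@ler_pXn2r _ 2)// ?nnegrE ?mulr_ge0// exprMn.
pose c := inner x y / `|y| ^+ 2.
have o : inner (x - c *: y) (c *: y) = 0.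
  by rewrite ipZr ipBl ipZl inner_norm /c divfK// subrr mulr0.
have := norm2D o; rewrite subrK => ->.
rewrite normrZ mulrDl -[leLHS]add0r lerD ?mulr_ge0 ?exprn_ge0//.
rewrite -exprMn /c normrM normfV (ger0_norm (exprn_ge0 2 (normr_ge0 y))).
by rewrite -[X in _ <= X ^+ 2]mulrA -expr2 divfK.
Qed.

End Hilbert.

(** * Operators given by orthonormal systems *)

Section Operators.
Context {R : realType} {H : hilbertType R}.
Implicit Types (x y z : H).

(** The vectors marked by [U] are orthonormal, the others are 0; a family indexed by all of [nat]
    can thus describe the images of a basis under a partial isometry. *)
Definition orthosys (U : pred nat) (u : nat -> H) :=
  forall a b, inner (u a) (u b) = ((a == b) && U a)%:R.

Lemma orthosys_norm U u a : orthosys U u -> `|u a| = (U a)%:R.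
Proof.
move=> /(_ a a); rewrite eqxx/=; case: (U a) => [/norm1_ip//|].
by rewrite inner_norm => /eqP; rewrite expf_eq0/= => /eqP.
Qed.

Lemma norm2_orthosys U u (c : nat -> R[i]) (r : seq nat) : orthosys U u -> uniq r ->
  `|\sum_(a <- r) c a *: u a| ^+ 2 = \sum_(a <- r | U a) `|c a| ^+ 2.
Proof.
move=> ou ur; rewrite norm2_sum_orth//; last first.
  by move=> a b _ _ /negPf ab; rewrite ipZl ipZr ou ab !mulr0.
rewrite [RHS]big_mkcond; apply: eq_bigr => a _.
by rewrite normrZ (orthosys_norm a ou) exprMn; case: (U a); rewrite ?expr1n ?mulr1 ?expr0n ?mulr0.
Qed.

Lemma bessel U u (r : seq nat) x : orthosys U u -> uniq r ->
  \sum_(a <- r | U a) `|inner x (u a)| ^+ 2 <= `|x| ^+ 2.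
Proof.
move=> ou ur; pose y := \sum_(a <- r) inner x (u a) *: u a.
have o : inner (x - y) y = 0.
  apply: ip_eq0C; rewrite /y ip_suml big_seq big1// => a ar.
  rewrite ipZl ipBr ip_sumr (bigD1_seq a)//= big1 => [|b /negPf ba].
    rewrite ipZr ou eqxx addr0 /= -ipC.
    case: (boolP (U a)) => Ua; first by rewrite mulr1 subrr mulr0.
    suff -> : u a = 0 by rewrite ip0r mul0r.
    by apply/eqP; rewrite -normr_eq0 (orthosys_norm a ou) (negPf Ua).
  by rewrite ipZr ou eq_sym ba mulr0.
rewrite -(norm2_orthosys _ ou ur) -/y.
by have := norm2D o; rewrite subrK => ->; rewrite lerDr exprn_ge0.
Qed.

Lemma bounded_operator_of_linear (f : H -> H) (M : R[i]) :
  linear f -> 0 <= M -> (forall x, `|f x| <= M * `|x|) ->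
  {T : bounded_operator H | T =1 f :> (H -> H)}.
Proof.
move=> lf M0 fM.
pose F : {linear H -> H} := HB.pack f (GRing.isLinear.Build _ _ _ _ f lf).
have cF : continuous F.
  apply: bounded_linear_continuous; apply/linear_boundedP.
  exists M; split; first exact: ger0_real.
  by move=> r Mr x; rewrite (le_trans (fM x))// ler_wpM2r// ltW.
have bF : f \in @is_bounded_operator _ H by apply/asboolP; split.
by exists (BoundedOperator bF).
Qed.

Section DiagonalOperator.
Variables (U W : pred nat) (u w : nat -> H).
Hypotheses (ou : orthosys U u) (ow : orthosys W w).

Let term x (a : nat) := inner x (u a) *: w a.

Lemma diagop_le x (r : seq nat) :
  \sum_(a <- r | W a) `|inner x (u a)| ^+ 2 <= \sum_(a <- r | U a) `|inner x (u a)| ^+ 2.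
Proof.
rewrite big_mkcond [leRHS]big_mkcond ler_sum// => a _.
case: ifP => _; case: (boolP (U a)) => // Ua; rewrite ?exprn_ge0//.
suff -> : u a = 0 by rewrite ip0r normr0 expr0n.
by apply/eqP; rewrite -normr_eq0 (orthosys_norm a ou) (negPf Ua).
Qed.

(** By Pythagoras the tails are controlled by those of the series of squared coefficients, whose
    partial sums increase and are bounded by Bessel's inequality. *)
Lemma diagop_cvg x : cvgn (series (term x)).
Proof.
have big_nat_le n m : \sum_(n <= a < m | U a) `|inner x (u a)| ^+ 2 <= `|x| ^+ 2.
  exact: bessel ou (iota_uniq _ _).
pose r a := complex.Re (if U a then `|inner x (u a)| ^+ 2 else 0).
have rE n m : \sum_(n <= a < m | U a) `|inner x (u a)| ^+ 2 = (\sum_(n <= a < m) r a)%:C%C.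
  rewrite big_mkcond /= rmorph_sum; apply: eq_bigr => a _.
  rewrite /r; case: ifP => _; first by rewrite [RHS]RRe_real// ger0_real// exprn_ge0.
  by rewrite [RHS]RRe_real//.
have r0 a : 0 <= r a.
  rewrite /r; case: ifP => // _.
  have : 0 <= `|inner x (u a)| ^+ 2 :> R[i] := exprn_ge0 2 (normr_ge0 _).
  by rewrite lecE => /andP[].
have cr : cvgn (series r).
  apply: nondecreasing_is_cvgn.
    by apply/nondecreasing_seqP => n; rewrite !seriesEnat/= big_nat_recr//= lerDl.
  exists (complex.Re (`|x| ^+ 2)) => _ [n _ <-]; rewrite seriesEnat /= -lecR -rE.
  by rewrite RRe_real// ger0_real// exprn_ge0.
apply: cauchy_cvg; apply/cauchy_seriesP => e e0.
have eE : e = (complex.Re e)%:C%C by rewrite RRe_real// ger0_real// ltW.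
have e0' : 0 < complex.Re e by rewrite -ltcR -eE.
have cauchy_r : cauchy (series r @ \oo)%classic by apply: cvg_cauchy.
move/cauchy_seriesP in cauchy_r.
have e20 : 0 < complex.Re e ^+ 2 by rewrite exprn_gt0.
near=> n.
have : `|\sum_(n.1 <= k < n.2) r k| < complex.Re e ^+ 2 by near: n; exact: cauchy_r e20.
rewrite ger0_norm ?sumr_ge0// => lt_e.
rewrite -(@ltr_pXn2r _ 2)// ?nnegrE ?(ltW e0)//.
rewrite (norm2_orthosys _ ow)// ?iota_uniq//.
rewrite (@le_lt_trans _ _ (\sum_(n.1 <= a < n.2 | U a) `|inner x (u a)| ^+ 2))//.
  exact: diagop_le.
by rewrite rE [X in _ < X ^+ 2]eE -rmorphXn ltcR.
Unshelve. all: by end_near. Qed.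

(** [T] sums [inner x (u a) *: w a] over all [a]. The formula is recorded only where it is a finite
    sum, which covers all vectors of the filtrations used below. *)
Lemma diagop_ex : {T : bounded_operator H |
  (forall x m, (forall a, (m <= a)%N -> inner x (u a) = 0) ->
    T x = \sum_(a < m) inner x (u a) *: w a) /\ `|T| <= 1}.
Proof.
pose L x := limn (series (term x)).
have cL x : (series (term x) @ \oo --> L x)%classic by exact: diagop_cvg.
have lL : linear L.
  move=> a x y; apply: cvg_lim; first exact: norm_hausdorff.
  have -> : series (term (a *: x + y)) =
            (fun n => a *: series (term x) n + series (term y) n).
    apply/funext => n; rewrite !seriesEnat /= scaler_sumr -big_split; apply: eq_bigr => b _.
    by rewrite /term ipDl ipZl scalerDl scalerA.
  by apply: cvgD => //; apply: cvgZl_tmp.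
have L1 x : `|L x| <= 1 * `|x|.
  rewrite mul1r real_leNgt ?normr_real//; apply/negP => xL.
  have near_gt : (\forall n \near \oo, `|x| < `|series (term x) n|)%classic.
    exact: cvgr_norm_gt (cL x) _ xL.
  have [n] := filter_ex near_gt; apply/negP; rewrite -real_leNgt ?normr_real//.
  rewrite seriesEnat /= -(@ler_pXn2r _ 2)// ?nnegrE//.
  rewrite (norm2_orthosys _ ow) ?iota_uniq//.
  rewrite (le_trans _ (bessel x ou (iota_uniq 0 (n - 0))))//.
  exact: diagop_le.
have [T TL] := bounded_operator_of_linear lL ler01 L1.
exists T; split.
  move=> x m um; rewrite TL; apply: cvg_lim; first exact: norm_hausdorff.
  apply: cvg_near_cst; exists m => // n /= mn.
  have tail0 : \sum_(m <= a < n) term x a = 0.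
    by rewrite big_nat big1// => a /andP[ma _]; rewrite /term um// scale0r.
  by rewrite seriesEnat /= (big_cat_nat (leq0n m) mn)//= tail0 addr0 big_mkord.
by apply: bop_norm_le => // x; rewrite TL.
Qed.

End DiagonalOperator.

End Operators.

(** * Dimension counts and orthonormal bases *)

Section FiniteDimension.
Context {R : realType} {H : hilbertType R}.
Implicit Types (x y z : H).

Lemma kernel_vector (F : fieldType) (n : nat) (T : finType) (P : {set T}) (M : 'I_n -> T -> F) :
  (#|P| < n)%N -> exists2 c : 'I_n -> F, (exists i, c i != 0) &
    forall t, t \in P -> \sum_i c i * M i t = 0.
Proof.
move=> Pn; pose A : 'M[F]_(n, #|P|) := \matrix_(i, j) M i (enum_val j).
have kA0 : kermx A != 0.
  rewrite -mxrank_eq0 mxrank_ker -lt0n subn_gt0.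
  exact: leq_ltn_trans (rank_leq_col A) Pn.
have [i ri] : exists i, row i (kermx A) != 0.
  apply/existsP; apply: contra_neqT kA0 => /existsPn k0.
  by apply/row_matrixP => i; rewrite row0; apply/eqP/negPn/k0.
exists (fun j => kermx A i j).
  have [j kj] : exists j, row i (kermx A) 0 j != 0.
    apply/existsP; apply: contra_neqT ri => /existsPn k0.
    by apply/rowP => j; rewrite [RHS]mxE; apply/eqP/negPn/k0.
  by exists j; move: kj; rewrite mxE.
move=> t tP; have kA : row i (kermx A) *m A = 0 by apply/sub_kermxP; exact: row_sub.
transitivity ((row i (kermx A) *m A) 0 (enum_rank_in tP t)); last by rewrite kA mxE.
rewrite mxE; apply: eq_bigr => j _.
by rewrite !mxE enum_rankK_in.
Qed.

Definition linform (f : H -> R[i]) :=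
  forall a x y, f (a *: x + y) = a * f x + f y.

Lemma linform_sum f (I : Type) (r : seq I) (P : pred I) (c : I -> R[i]) (u : I -> H) :
  linform f ->
  f (\sum_(i <- r | P i) c i *: u i) = \sum_(i <- r | P i) c i * f (u i).
Proof.
move=> lf; have f0 : f 0 = 0.
  by have := lf (-1) 0 0; rewrite scaler0 add0r mulN1r addNr.
elim/big_rec2: _ => [//|i y x _ <-]; exact: lf.
Qed.

Lemma linform_ip (y : H) : linform (fun x => inner x y).
Proof. by move=> a x z; rewrite ipDl ipZl. Qed.

Lemma unit_vector (n : nat) (u : 'I_n -> H) (T : finType) (P : {set T}) (f : T -> H -> R[i]) :
  (forall c : 'I_n -> R[i], \sum_i c i *: u i = 0 -> forall i, c i = 0) ->
  (forall t, linform (f t)) -> (#|P| < n)%N ->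
  exists c : 'I_n -> R[i], let x := \sum_i c i *: u i in
    inner x x = 1 /\ forall t, t \in P -> f t x = 0.
Proof.
move=> fu lf /kernel_vector - /(_ _ (fun i t => f t (u i)))[c [i ci] cM].
pose x := \sum_i c i *: u i.
have x0 : x != 0 by apply: contra_neq ci => /fu.
exists (fun i => `|x|^-1 * c i) => y.
have yE : y = `|x|^-1 *: x.
  by rewrite /y /x scaler_sumr; apply: eq_bigr => j _; rewrite scalerA.
split; first by rewrite inner_norm yE normfZV// expr1n.
move=> t tP; rewrite /y linform_sum//.
under eq_bigr do rewrite -mulrA.
by rewrite -mulr_sumr cM// mulr0.
Qed.

Definition proj_on (u : nat -> H) n x := \sum_(i < n) inner x (u i) *: u i.

Lemma ip_comb (u : nat -> H) n (c : nat -> R[i]) (j : nat) :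
  (forall a b, (a < n)%N -> (b < n)%N -> inner (u a) (u b) = (a == b)%:R) -> (j < n)%N ->
  inner (\sum_(i < n) c i *: u i) (u j) = c j.
Proof.
move=> ou jn; rewrite ip_suml (bigD1 (Ordinal jn))//= ipZl ou// eqxx mulr1 big1 ?addr0//.
move=> i /negPf ij; rewrite ipZl ou//.
by rewrite -[(i : nat) == j]/(i == Ordinal jn) ij mulr0.
Qed.

(** Gram-Schmidt by counting: while [d < n] vectors are chosen, [V] contains a unit vector
    orthogonal to them. *)
Lemma has_dim_orthonormal (V : set H) n : has_dim V n ->
  exists o : nat -> H,
    (forall a b, (a < n)%N -> (b < n)%N -> inner (o a) (o b) = (a == b)%:R) /\
    (forall x, V x <-> x = proj_on o n x).
Proof.
move=> [u [fu ->]].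
pose S := [set x | exists c : 'I_n -> R[i], x = \sum_i c i *: u i]%classic.
have SD (a : R[i]) (x y : H) : S x -> S y -> S (a *: x + y).
  move=> [c ->] [d ->]; exists (fun i => a * c i + d i).
  rewrite scaler_sumr -big_split; apply: eq_bigr => i _.
  by rewrite scalerDl scalerA.
have S0 : S 0 by exists (fun=> 0); rewrite big1// => i _; rewrite scale0r.
have Ssum (r : seq nat) (c : nat -> R[i]) (v : nat -> H) :
    (forall i, i \in r -> S (v i)) -> S (\sum_(i <- r) c i *: v i).
  elim: r => [|i r IH] Sv; first by rewrite big_nil.
  rewrite big_cons; apply: SD; first by apply: Sv; rewrite mem_head.
  by apply: IH => j jr; apply: Sv; rewrite inE jr orbT.
have [ o [oo oS]] : exists o : nat -> H,
    (forall a b, (a < n)%N -> (b < n)%N -> inner (o a) (o b) = (a == b)%:R) /\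
    (forall a, (a < n)%N -> S (o a)).
  suff : forall d, (d <= n)%N -> exists o : nat -> H,
      (forall a b, (a < d)%N -> (b < d)%N -> inner (o a) (o b) = (a == b)%:R) /\
      (forall a, (a < d)%N -> S (o a)) by apply.
  elim=> [_|d IH dn]; first by exists (fun=> 0).
  have [ o [oo oS]] := IH (ltnW dn).
  have card_d : (#|[set: 'I_d]| < n)%N by rewrite cardsT card_ord.
  have [c [xx ox]] := unit_vector fu (fun t : 'I_d => linform_ip (o t)) card_d.
  set x := (\sum_i _) in xx ox.
  have xo (i : nat) : (i < d)%N -> inner x (o i) = 0.
    by move=> id; apply: (ox (Ordinal id)); rewrite inE.
  exists (fun a => if (a < d)%N then o a else x); split.
    move=> a b; rewrite !ltnS.
    rewrite (leq_eqVlt a) (leq_eqVlt b) => /predU1P[->|ad] /predU1P[->|bd]; rewrite ?ltnn ?ad ?bd.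
    - by rewrite xx eqxx.
    - by rewrite xo// gtn_eqF.
    - by rewrite (ip_eq0C (xo _ ad)) ltn_eqF.
    - exact: oo.
  by move=> a _; case: ifP => [/oS//|_]; exists c.
exists o; split=> // x; split=> [Sx|->]; last first.
  rewrite /proj_on -(big_mkord xpredT (fun i => inner x (o i) *: o i)).
  by apply: Ssum => i; rewrite mem_index_iota => /andP[_]; exact: oS.
pose y := x - proj_on o n x.
have Sy : S y.
  rewrite /y addrC -scaleN1r; apply: SD => //.
  rewrite /proj_on -(big_mkord xpredT (fun i => inner x (o i) *: o i)).
  by apply: Ssum => i; rewrite mem_index_iota => /andP[_]; exact: oS.
have oy (i : nat) : (i < n)%N -> inner y (o i) = 0.
  move=> ni; rewrite ipBl /proj_on.
  by rewrite (ip_comb (fun i => inner x (o i)) oo ni) subrr.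
(* The [n] vectors of [o] and [y] are dependent in an [n]-dimensional space; orthogonality kills
   every coefficient except that of [y]. *)
suff y0 : y = 0 by apply/eqP; rewrite -subr_eq0 -/y y0.
pose v (i : 'I_n.+1) := if (i < n)%N then o i else y.
have Sv (i : 'I_n.+1) : exists c : 'I_n -> R[i], v i = \sum_j c j *: u j.
  by rewrite /v; case: ifP => // /oS.
have [M vM] := choice Sv.
have card_n : (#|[set: 'I_n]| < n.+1)%N by rewrite cardsT card_ord.
have [c [i ci] cM] := kernel_vector M card_n.
have cv0 : \sum_i c i *: v i = 0.
  under eq_bigr do rewrite vM scaler_sumr.
  rewrite exchange_big big1//= => j _.
  under eq_bigr do rewrite scalerA.
  by rewrite -scaler_suml cM ?inE ?scale0r.
have vy (i' : nat) : (i' < n)%N -> c (inord i') = 0.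
  move=> i'n; have i'n1 : (i' < n.+1)%N by exact: ltnW.
  have := ip0l (o i'); rewrite -cv0 ip_suml (bigD1 (inord i'))//= big1 ?addr0.
    by rewrite ipZl /v inordK// i'n oo// eqxx mulr1.
  move=> j /negPf ji; rewrite ipZl /v; case: ifP => jn; last by rewrite oy// mulr0.
  rewrite oo//; case: eqP => [ji'|_]; last by rewrite mulr0.
  by move: ji; rewrite -ji' inord_val eqxx.
have iE : i = ord_max.
  apply/val_inj/eqP; rewrite /= eqn_leq -ltnS ltn_ord leqNgt /=.
  by apply: contraNN ci => /vy; rewrite inord_val => ->.
move: cv0; rewrite big_ord_recr /= big1 => [|j _]; last first.
  by rewrite -[widen_ord _ _]inord_val /= vy ?scale0r.
rewrite add0r {1}/v ltnn => /eqP; rewrite scaler_eq0 -iE (negPf ci) => /eqP.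
by [].
Qed.

End FiniteDimension.

(** * Bases adapted to a nest *)

Section NestBasis.
Context {R : realType} {H : hilbertType R}.
Implicit Types (x y z : H) (e : nat -> H).

(** For a total orthonormal [e] this is the span of the first [m] vectors, by [span_expand]. *)
Definition span_upto e m : set H := [set x | forall a, (m <= a)%N -> inner x (e a) = 0].

Definition total_system e := forall x, (forall a, inner x (e a) = 0) -> x = 0.

Lemma proj_on_add e m l x : 
  proj_on e (m + l) x = proj_on e m x + proj_on (fun i => e (m + i)%N) l x.
Proof. by rewrite /proj_on big_split_ord. Qed.

Lemma nest_le (N : omega_nest H) k l x : (k <= l)%N -> N k x -> N l x.
Proof.
move=> kl Nx; elim: l kl => [|l IH]; first by rewrite leqn0 => /eqP <-.
rewrite leq_eqVlt => /predU1P[<-//|]; rewrite ltnS => /IH.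
by apply: (properW (nest_lt N l)).
Qed.

Lemma nest_sum (N : omega_nest H) k (I : finType) (c : I -> R[i]) (u : I -> H) :
  (forall i, N k (u i)) -> N k (\sum_i c i *: u i).
Proof.
move=> Nu; have [/[!inE] N0 ND] := nest_submod N k.
elim/big_rec: _ => [|i x _ Nx]; first exact: N0.
by have := ND (c i) (u i) x; rewrite !inE; apply.
Qed.

Variables (N : omega_nest H) (n : nat -> nat).
Hypothesis hn : forall k : nat, (1 <= k)%N -> has_dim (atom N k) (n k).
Let s := partial_dim n.

(** Orthonormal bases of the atoms are concatenated, so that the nest algebra consists of block
    upper triangular operators. *)
Theorem nest_basis : exists e, [/\ orthosys xpredT e, total_system e,
  forall k, (0 < n k.+1)%N & forall k, N k = span_upto e (s k)].
Proof.
have /choice[ o oP] : forall k, exists u : nat -> H,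
    (forall a b, (a < n k.+1)%N -> (b < n k.+1)%N -> inner (u a) (u b) = (a == b)%:R) /\
    (forall x, atom N k.+1 x <-> x = proj_on u (n k.+1) x).
  by move=> k; exact: has_dim_orthonormal (hn (ltn0Sn k)).
pose e a := xget 0 [set y | exists k i, [/\ (i < n k.+1)%N, a = (s k + i)%N & y = o k i]]%classic.
have eE k i : (i < n k.+1)%N -> e (s k + i)%N = o k i.
  move=> ik; rewrite /e; case: xgetP => [y _ [j [l [lj]]]|/(_ (o k i)) []]; last by exists k, i.
  by move=> /(partial_dim_inj ik lj)[-> ->].
have atomo k i : (i < n k.+1)%N -> atom N k.+1 (o k i).
  move=> ik; apply/(oP k).2; rewrite /proj_on (bigD1 (Ordinal ik))//= (oP k).1// eqxx.
  rewrite scale1r big1 ?addr0// => j /negPf ji; rewrite (oP k).1//.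
  by rewrite eq_sym -[_ == _]/(j == Ordinal ik) ji scale0r.
have eN k a : (a < s k)%N -> N k (e a).
  move=> /partial_dim_block[j [i [jk ij ->]]]; rewrite eE//.
  by apply: (nest_le jk); exact: (atomo j i ij).1.
have oe k a b : (a < s k)%N -> (b < s k)%N -> inner (e a) (e b) = (a == b)%:R.
  move=> /partial_dim_block[j [i [jk ij ->]]] /partial_dim_block[l [i' [lk il ->]]].
  have [jl|lj|jl] := ltngtP j l.
  - rewrite ltn_eqF; last first.
      rewrite ltn_addr// (@leq_trans (s j.+1))// ?partial_dim_le//.
      by rewrite /s partial_dimS ltn_add2l.
    rewrite !eE// (ip_eq0C ((atomo l i' il).2 _ _))//=.
    by apply: (nest_le jl); exact: (atomo j i ij).1.
  - rewrite gtn_eqF; last first.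
      rewrite ltn_addr// (@leq_trans (s l.+1))// ?partial_dim_le//.
      by rewrite /s partial_dimS ltn_add2l.
    rewrite !eE// ((atomo j i ij).2 _ _)//=.
    by apply: (nest_le lj); exact: (atomo l i' il).1.
  - by subst l; rewrite !eE// (oP j).1// eqn_add2l.
have Nproj k x : N k (proj_on e (s k) x).
  by apply: nest_sum => i; exact: eN.
(* Subtracting from a vector of [N k.+1] its projection onto [N k] leaves a vector of the next
   atom. *)
have NE k x : N k x <-> x = proj_on e (s k) x.
  split=> [|->//]; elim: k x => [|k IH] x.
    by rewrite nest0 => ->; rewrite /proj_on /s /partial_dim !big_ord0.
  move=> Nx; rewrite /s partial_dimS proj_on_add -/s.
  pose y := x - proj_on e (s k) x.
  have ye a : (a < s k)%N -> inner y (e a) = 0.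
    by move=> ak; rewrite ipBl (ip_comb (fun i => inner x (e i)) (oe k) ak) subrr.
  have ay : atom N k.+1 y.
    split=> [|z /= /IH ->].
      have [_ ND] := nest_submod N k.+1.
      have -> : y = -1 *: proj_on e (s k) x + x by rewrite scaleN1r addrC.
      have := ND (-1) (proj_on e (s k) x) x; rewrite !inE; apply=> //.
      exact: nest_le (leqnSn k) (Nproj k x).
    by rewrite ip_sumr big1// => i _; rewrite ipZr ye ?mulr0.
  apply/eqP; rewrite addrC -subr_eq -/y; apply/eqP.
  rewrite {1}((oP k).2 y).1//; apply: eq_bigr => i _.
  rewrite -eE// ipBl [X in _ - X]ip_suml big1 ?subr0// => j _.
  rewrite ipZl (oe k.+1) ?ltn_eqF ?mulr0 ?ltn_addr//.
    by rewrite (leq_trans (ltn_ord j))// partial_dim_le.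
  by rewrite /s partial_dimS ltn_add2l.
have n0 k : (0 < n k.+1)%N.
  rewrite lt0n; apply/eqP => nk0; have [_] := nest_lt N k; apply => x /NE xE.
  by apply/NE; rewrite [LHS]xE /s partial_dimS nk0 addn0.
have s_ge k : (k <= s k)%N.
  elim: k => // k IH; have := leq_add IH (n0 k).
  by rewrite addn1 /s partial_dimS.
have oxe : orthosys xpredT e.
  move=> a b; rewrite andbT (oe (maxn a b).+1)//.
    by rewrite (leq_trans _ (s_ge _))// ltnS leq_maxl.
  by rewrite (leq_trans _ (s_ge _))// ltnS leq_maxr.
(* If [x] is orthogonal to the basis, it is orthogonal to every [y] in the union of the nest, so
   [|x - y| >= |x|]; density forces [x = 0]. *)
have te : total_system e.
  move=> x xe; apply: contrapT => /eqP x0.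
  have := @nest_dense _ _ N (ball x `|x|).
  case.
  - by exists x; apply: ballxx; rewrite normr_gt0.
  - by apply: ball_open; rewrite normr_gt0.
  move=> y []; rewrite -ball_normE /= => xy [k _ /NE yE].
  have xy0 : inner x (- y) = 0.
    rewrite ipNr yE ip_sumr big1 ?oppr0// => i _; by rewrite ipZr xe mulr0.
  move: xy; rewrite -(@ltr_pXn2r _ 2)// ?nnegrE//.
  by rewrite (norm2D xy0) gtrDl le_gtF ?exprn_ge0.
exists e; split=> // k; apply/seteqP; split=> x.
  move=> /NE -> a ka; rewrite ip_suml big1// => i _.
  by rewrite ipZl oxe andbT ltn_eqF ?mulr0// (leq_trans (ltn_ord i)).
move=> /= xe; apply/NE/eqP; rewrite -subr_eq0; apply/eqP/te => a.
have [ak|ka] := ltnP a (s k).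
  by rewrite ipBl (ip_comb (fun i => inner x (e i)) (oe k) ak) subrr.
rewrite ipBl xe// ip_suml big1 ?subr0// => i _.
by rewrite ipZl oxe andbT ltn_eqF ?mulr0// (leq_trans (ltn_ord i)).
Qed.

End NestBasis.

(** * The stable rank through approximation of rows *)

Lemma rtsr_candidateP (K : numFieldType) (A : banachAlgType K) (p : nat) :
  rtsr_candidate A p <-> (0 < p)%N /\ forall (a : 'I_p -> A) (eps : K), 0 < eps ->
    exists a' b : 'I_p -> A, (forall i, `|a' i - a i| < eps) /\
      \sum_i bamul (a' i) (b i) = baone.
Proof.
split=> [/asboolP[p0 dA]|[p0 dA]].
  split=> // a eps eps0; pose r : 'rV[A]_p := \row_i a i.
  have := dA (interior (ball r eps)); case.
  - exists r; apply: nbhs_singleton; apply: nbhs_interior; exact: nbhsx_ballx.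
  - exact: open_interior.
  move=> r' [/interior_subset rr' [b b1]]; exists (fun i => r' 0 i), (fun i => b 0 i); split=> // i.
  have [_ /(_ 0 i)] := rr'; rewrite -ball_normE /= mxE distrC; exact.
apply/asboolP; split=> // O [r Or] oO.
have /nbhs_ballP[eps eps0 rO] : nbhs r O by exact: open_nbhs_nbhs.
have [a [b [aa ab]]] := dA (fun i => r 0 i) eps eps0.
exists (\row_i a i); split.
  apply: rO; split=> // i j; rewrite -ball_normE /= mxE distrC ord1; exact: aa.
by exists (\row_i b i); rewrite -ab; apply: eq_bigr => i _; rewrite !mxE.
Qed.

Lemma rtsr_none (K : numFieldType) (A : banachAlgType K) :
  (forall p, ~ rtsr_candidate A p) -> rtsr A = None.
Proof.
move=> nA; rewrite /rtsr; case: pselect => // ex; exfalso.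
by case: ex => p; exact: nA.
Qed.

Lemma rtsr_two (K : numFieldType) (A : banachAlgType K) :
  rtsr_candidate A 2 -> ~ rtsr_candidate A 1 -> rtsr A = Some 2.
Proof.
move=> A2 A1; rewrite /rtsr; case: pselect => [ex|[]]; last by exists 2.
case: ex_minnP => m Am m_min; have m2 := m_min _ A2; congr Some; move: Am m2 {m_min}.
case: m => [|[|[|m]]]// Am; first by case/asboolP: Am.
Qed.

(** * Operators in an adapted basis *)

Section AdaptedBasis.
Context {R : realType} {H : hilbertType R}.
Implicit Types (x y z : H) (e : nat -> H) (S T : bounded_operator H).

Lemma basis_norm e a : orthosys xpredT e -> `|e a| = 1.
Proof. by move=> oe; rewrite (orthosys_norm a oe). Qed.

Lemma ip_basis e a b : orthosys xpredT e -> inner (e a) (e b) = (a == b)%:R.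
Proof. by move=> /(_ a b); rewrite andbT. Qed.

Lemma span_expand e m x : orthosys xpredT e -> total_system e ->
  span_upto e m x -> x = proj_on e m x.
Proof.
move=> oe te xe; apply/eqP; rewrite -subr_eq0; apply/eqP/te => a.
have [am|ma] := ltnP a m.
  rewrite ipBl (@ip_comb _ _ e m (fun i => inner x (e i)))// ?subrr// => *.
  exact: ip_basis.
rewrite ipBl xe// ip_suml big1 ?subr0// => i _.
by rewrite ipZl ip_basis// ltn_eqF ?mulr0// (leq_trans (ltn_ord i)).
Qed.

Lemma span_uptoD e m a x y : span_upto e m x -> span_upto e m y -> span_upto e m (a *: x + y).
Proof. by move=> xe ye b mb; rewrite ipDl ipZl xe// ye// mulr0 addr0. Qed.

Lemma span_upto_sum e m (I : Type) (r : seq I) (P : pred I) (c : I -> R[i]) (u : I -> H) :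
  (forall i, P i -> c i = 0 \/ span_upto e m (u i)) ->
  span_upto e m (\sum_(i <- r | P i) c i *: u i).
Proof.
move=> ue; elim/big_rec: _ => [b _|i x Pi]; first exact: ip0l.
by case: (ue i Pi) => [->|/span_uptoD]; [rewrite scale0r add0r|apply].
Qed.

Lemma span_uptoB e m x y : span_upto e m x -> span_upto e m y -> span_upto e m (x - y).
Proof. by move=> xe ye b mb; rewrite ipBl xe// ye// subrr. Qed.

Lemma span_upto_add e m x y : span_upto e m x -> span_upto e m y -> span_upto e m (x + y).
Proof. by move=> xe ye b mb; rewrite ipDl xe// ye// addr0. Qed.

Lemma span_uptoZ e m (c : R[i]) x : span_upto e m x -> span_upto e m (c *: x).
Proof. by move=> xe b mb; rewrite ipZl xe// mulr0. Qed.

Lemma span_upto_sum1 e m (J : Type) (q : seq J) (P : pred J) (z : J -> H) :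
  (forall j, P j -> span_upto e m (z j)) -> span_upto e m (\sum_(j <- q | P j) z j).
Proof. by move=> ze b mb; rewrite ip_suml big1// => j Pj; apply: ze. Qed.

Lemma span_upto_le e m l x : (m <= l)%N -> span_upto e m x -> span_upto e l x.
Proof. by move=> ml xe a la; apply: xe; exact: leq_trans la. Qed.

Lemma span_upto_basis e m a : orthosys xpredT e -> (a < m)%N -> span_upto e m (e a).
Proof. by move=> oe am b mb; rewrite ip_basis// ltn_eqF// (leq_trans am). Qed.

Lemma bopB T x y : T (x - y) = T x - T y.
Proof. exact: linearB. Qed.

Lemma bopD T x y : T (x + y) = T x + T y.
Proof. exact: linearD. Qed.

Lemma bopZ T a x : T (a *: x) = a *: T x.
Proof. exact: linearZ. Qed.

Lemma bop0 T : T 0 = 0.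
Proof. exact: linear0. Qed.

Lemma bop_sum (I : Type) (r : seq I) (P : pred I) (F : I -> bounded_operator H) x :
  (\sum_(i <- r | P i) F i) x = \sum_(i <- r | P i) F i x.
Proof. by elim/big_rec2: _ => // i y T _ <-. Qed.

Lemma bop_comb T (I : Type) (r : seq I) (P : pred I) (c : I -> R[i]) (u : I -> H) :
  T (\sum_(i <- r | P i) c i *: u i) = \sum_(i <- r | P i) c i *: T (u i).
Proof. by rewrite linear_sum; apply: eq_bigr => i _; rewrite linearZ. Qed.

Lemma span_upto_map e f m l T : orthosys xpredT e -> total_system e ->
  (forall a, (a < m)%N -> span_upto f l (T (e a))) ->
  forall x, span_upto e m x -> span_upto f l (T x).
Proof.
move=> oe te Te x /(span_expand oe te) ->; rewrite bop_comb.
by apply: span_upto_sum => i _; right; exact: Te.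
Qed.

Lemma diagop_basis e (W : pred nat) (w : nat -> H) : orthosys xpredT e -> orthosys W w ->
  {T : bounded_operator H | (forall a, T (e a) = w a) /\ `|T| <= 1}.
Proof.
move=> oe ow; have [T [Te T1]] := diagop_ex oe ow.
exists T; split=> // a; rewrite (Te _ a.+1) => [|b ab]; last first.
  by rewrite ip_basis// ltn_eqF.
rewrite big_ord_recr/= ip_basis// eqxx scale1r big1 ?add0r// => i _.
by rewrite ip_basis// gtn_eqF// scale0r.
Qed.

Lemma bop_ext (N : omega_nest H) S T : (forall k x, N k x -> S x = T x) -> S = T.
Proof.
move=> ST; apply/bopP => x; apply: contrapT => /eqP; rewrite -subr_eq0 => Dx.
have Dx0 : 0 < `|(S - T) x| by rewrite normr_gt0.
have D1 : 0 < `|S - T| + 1 by rewrite ltr_wpDl.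
have := @nest_dense _ _ N (ball x (`|(S - T) x| / (`|S - T| + 1))).
case; [by exists x; apply: ballxx; rewrite divr_gt0|by apply: ball_open; rewrite divr_gt0|].
move=> y []; rewrite -ball_normE /= => xy [k _ /ST STy].
have : `|(S - T) x| < `|(S - T) x|; last by rewrite ltxx.
have Dy : (S - T) y = 0 by rewrite -[LHS]/(S y - T y) STy subrr.
have {1}-> : (S - T) x = (S - T) (x - y) by rewrite bopB Dy subr0.
rewrite (le_lt_trans (ler_norm_bop _ _))//.
rewrite (@le_lt_trans _ _ ((`|S - T| + 1) * `|x - y|))//.
  by rewrite ler_wpM2r// lerDl.
by rewrite mulrC -ltr_pdivlMr.
Qed.

End AdaptedBasis.

(** * Deep sequences: no row length is enough *)

Section RowObstructions.
Context {R : realType} {H : hilbertType R}.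
Variables (N : omega_nest H) (e : nat -> H) (s : nat -> nat).
Hypotheses (oe : orthosys xpredT e) (te : total_system e).
Hypothesis (Ns : forall k, N k = span_upto e (s k)).
Implicit Types (x y z : H) (S T : bounded_operator H).

Lemma in_nest_algebra_basis T :
  (forall k a, (a < s k)%N -> span_upto e (s k) (T (e a))) -> T \in in_nest_algebra N.
Proof.
move=> Te; apply/in_nest_algebraP => k x; rewrite Ns; apply: span_upto_map => //.
exact: Te.
Qed.

Lemma sqr_sum_le (p : nat) (c : 'I_p -> R[i]) : (forall i, 0 <= c i) ->
  (\sum_i c i) ^+ 2 <= p%:R * \sum_i c i ^+ 2.
Proof.
move=> c0; rewrite expr2 big_distrlr /=.
have le2 (i j : 'I_p) : c i * c j <= 2^-1 * (c i ^+ 2 + c j ^+ 2).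
  rewrite -subr_ge0; have -> : 2^-1 * (c i ^+ 2 + c j ^+ 2) - c i * c j = 2^-1 * (c i - c j) ^+ 2.
    by field.
  by rewrite mulr_ge0// real_exprn_even_ge0// rpredB// ger0_real.
apply: (le_trans (ler_sum _ (fun i _ => ler_sum _ (fun j _ => le2 i j)))).
have inner_sum (i : 'I_p) : \sum_j 2^-1 * (c i ^+ 2 + c j ^+ 2) =
    2^-1 * (c i ^+ 2 *+ p + \sum_j c j ^+ 2).
  by rewrite -mulr_sumr big_split /= sumr_const card_ord.
rewrite (eq_bigr _ (fun i _ => inner_sum i)).
rewrite -mulr_sumr big_split /= sumr_const card_ord sumrMnl -mulr_natl.
by rewrite le_eqVlt; apply/orP; left; apply/eqP; field.
Qed.

Section RowObstruction.
Variables (p : nat) (g : nat -> 'I_p -> option nat).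
Hypothesis p_gt0 : (0 < p)%N.
Hypothesis g_tri : forall b i c k, g b i = Some c -> (b < s k)%N -> (c < s k)%N.
Hypothesis g_inj : forall b b' i i' c, g b i = Some c -> g b' i' = Some c -> b = b' /\ i = i'.

(** [g] encodes a row of partial isometries with mutually orthogonal ranges, [None] standing for the
    image 0. [g_tri] puts them into the nest algebra; [g_inj] keeps all targets distinct. *)
Let w i b := if g b i is Some c then e c else 0.

Lemma shift_orthosys i : orthosys (fun b => g b i : bool) (w i).
Proof.
move=> a b; rewrite /w; case ga: (g a i) => [c|]; last by rewrite ip0l andbF.
case gb: (g b i) => [c'|]; last first.
  by rewrite ip0r andbT; case: eqP => // ab; rewrite ab gb in ga.
rewrite ip_basis// andbT; case: (eqVneq a b) => [ab|ab].
  by rewrite -ab ga in gb; case: gb => ->; rewrite eqxx.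
case: eqP => // cc; rewrite -cc in gb.
by have [E _] := g_inj ga gb; rewrite E eqxx in ab.
Qed.

Lemma shift_row : {A : 'I_p -> nest_algebra N | forall i b, A i (e b) = w i b}.
Proof.
have tri i T : (forall b, T (e b) = w i b) -> T \in in_nest_algebra N.
  move=> Te; apply: in_nest_algebra_basis => k b bk; rewrite Te /w.
  case gb: (g b i) => [c|]; last by move=> l _; rewrite ip0l.
  by apply: span_upto_basis => //; exact: g_tri gb bk.
pose D i := projT1 (diagop_basis oe (shift_orthosys i)).
have DE i b : D i (e b) = w i b by have [+ _] := projT2 (diagop_basis oe (shift_orthosys i)); apply.
by exists (fun i => NestAlgebra (tri i (D i) (DE i))).
Qed.

Lemma row_expansion (t : 'I_p -> H) (A : 'I_p -> nest_algebra N) (m E : nat) (x : 'I_p -> H) :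
  (forall i b, A i (e b) = w i b) ->
  (forall i, t i = \sum_(m <= b < E) inner (x i) (e b) *: e b) ->
  forall c, inner (\sum_i A i (t i)) (e c) =
    \sum_i \sum_(m <= b < E) inner (x i) (e b) * (g b i == Some c)%:R.
Proof.
move=> Ae tE c; rewrite ip_suml; apply: eq_bigr => i _.
rewrite tE bop_comb ip_suml; apply: eq_bigr => b _.
rewrite ipZl Ae /w; case: (g b i) => [d|]; last by rewrite ip0l.
by rewrite ip_basis.
Qed.

Definition energy (x : 'I_p -> H) m E : R[i] :=
  \sum_i \sum_(m <= b < E) `|inner (x i) (e b)| ^+ 2.

(* Bessel's inequality for D = sum_i (A' i - A i) (t i), where t i is the part of
   B i e_b0 outside N_j0: D has coefficient 1 at e_b0 and, up to sign, those of
   the B i e_b0 at the e_(g b i). *)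
Lemma row_gain (eps : R[i]) (A A' B : 'I_p -> nest_algebra N) (j0 j1 k b0 : nat) :
  (forall i b, A i (e b) = w i b) ->
  0 <= eps -> (forall i, `|A' i - A i| <= eps) ->
  \sum_i bamul (A' i) (B i) = baone ->
  (s j0 <= b0 < s k)%N -> (s j0 <= s j1 <= s k)%N ->
  (forall b i, (b < s k)%N -> g b i <> Some b0) ->
  (forall b i, (s j1 <= b < s k)%N -> exists2 c, g b i = Some c & (s j0 <= c)%N) ->
  1 + energy (fun i => B i (e b0)) (s j1) (s k) <=
  eps ^+ 2 * p%:R * energy (fun i => B i (e b0)) (s j0) (s k).
Proof.
move=> Ae eps0 AA AB /andP[jb0 b0k] /andP[j01 j1k] gb0 gtot.
pose x i := B i (e b0); rewrite -/x; set m := s j0 in jb0 j01 *.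
have xk i : span_upto e (s k) (x i).
  by rewrite -Ns; apply: nest_stable; rewrite Ns; exact: span_upto_basis.
pose t i := \sum_(m <= b < s k) inner (x i) (e b) *: e b.
pose u i := proj_on e m (x i).
have xE i : x i = u i + t i.
  rewrite {1}(span_expand oe te (xk i)) /proj_on.
  rewrite -(big_mkord xpredT (fun b => inner (x i) (e b) *: e b)).
  by rewrite (big_cat_nat (leq0n m))/= ?big_mkord// (leq_trans j01).
have A'x : \sum_i A' i (x i) = e b0.
  rewrite -[RHS]/((baone : nest_algebra N) (e b0)) -AB.
  elim/big_rec2: _ => [|i y T _ ->]; first by [].
  by [].
(* The part [u i] lies in [N j0], which [A' i] preserves, so from index [m] on only the parts [t i]
   contribute. *)
have ut c : (m <= c)%N -> inner (\sum_i A' i (t i)) (e c) = (b0 == c)%:R.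
  move=> mc; rewrite -(ip_basis b0 c oe) -A'x !ip_suml; apply: eq_bigr => i _.
  rewrite xE bopD ipDl [X in _ = X + _](_ : _ = 0) ?add0r//.
  have : N j0 (A' i (u i)).
    apply: nest_stable; rewrite Ns; apply: span_upto_sum => b _; right.
    exact: span_upto_basis.
  by rewrite Ns; apply.
pose D := \sum_i (A' i - A i) (t i).
have DE c : (m <= c)%N -> inner D (e c) = (b0 == c)%:R -
    \sum_i \sum_(m <= b < s k) inner (x i) (e b) * (g b i == Some c)%:R.
  move=> mc; rewrite -ut// -(@row_expansion t A m (s k) x)//.
  by rewrite -ipBl -sumrB.
have t2 i : `|t i| ^+ 2 = \sum_(m <= b < s k) `|inner (x i) (e b)| ^+ 2.
  by rewrite (norm2_orthosys _ oe) ?iota_uniq.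
have D2 : `|D| ^+ 2 <= eps ^+ 2 * p%:R * energy x m (s k).
  have D1 : `|D| <= \sum_i eps * `|t i|.
    rewrite (le_trans (ler_norm_sum _ _ _))// ler_sum// => i _.
    rewrite (le_trans (ler_norm_bop _ _))// ler_wpM2r//.
    exact: AA.
  rewrite (@le_trans _ _ ((\sum_i eps * `|t i|) ^+ 2))//.
    by rewrite ler_pXn2r// ?nnegrE// sumr_ge0// => i _; rewrite mulr_ge0.
  rewrite (le_trans (sqr_sum_le _))// => [i|]; first by rewrite mulr_ge0.
  rewrite -mulrA mulrCA ler_wpM2l// mulr_sumr ler_sum// => i _.
  by rewrite exprMn t2.
apply: le_trans D2.
(* Bessel's inequality is tested on [b0] and on the targets of the pairs in [idx]. These indices are
   distinct, and at each target a single term of the double sum survives. *)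
pose idx := [seq (b, i) | b <- index_iota (s j1) (s k), i <- index_enum 'I_p].
have idxP b i : (b, i) \in idx -> (s j1 <= b < s k)%N.
  by move=> /allpairsP[[b' i'] /= []]; rewrite mem_index_iota => ? _ [-> _].
pose G (bi : nat * 'I_p) := odflt 0%N (g bi.1 bi.2).
have GP b i : (b, i) \in idx -> g b i = Some (G (b, i)) /\ (m <= G (b, i))%N.
  by move=> /idxP /gtot -/(_ i)[c gc mc]; rewrite /G /= gc.
have ur : uniq (b0 :: map G idx).
  rewrite /= map_inj_in_uniq ?allpairs_uniq ?iota_uniq ?index_enum_uniq ?andbT//.
  - apply/negP => /mapP[[b i] bi b0E]; have [gE _] := GP _ _ bi.
    by apply: (gb0 b i); [case/andP: (idxP _ _ bi)|rewrite gE b0E].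
  - by move=> [b i] [b' i'] _ _ [-> ->].
  - move=> [b i] [b' i'] /GP[gb _] /GP[gb' _] GG; rewrite -GG in gb'.
    by have [-> ->] := g_inj gb gb'.
have := bessel D oe ur; rewrite big_cons /= => /(le_trans _); apply.
apply: lerD.
  rewrite DE// eqxx big1 ?subr0 ?normr1 ?expr1n// => i _.
  rewrite big_nat big1// => b /andP[_ bk].
  by case: eqP; [move=> /gb0; rewrite bk => /(_ isT)|rewrite mulr0].
rewrite /energy exchange_big /= big_map big_allpairs_dep /=.
rewrite big_seq [leRHS]big_seq ler_sum// => b bk; rewrite ler_sum// => i _.
have bi : (b, i) \in idx by rewrite allpairs_f ?mem_index_enum.
have [gb mG] := GP _ _ bi.
have bk' : (b < s k)%N by case/andP: (idxP _ _ bi).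
have mb : (m <= b)%N by case/andP: (idxP _ _ bi) => + _; exact: leq_trans.
rewrite DE// (_ : b0 == _ = false); last first.
  by apply/eqP => b0E; apply: (gb0 b i bk'); rewrite gb b0E.
rewrite sub0r normrN (bigD1 i)//= [X in _ + X]big1 ?addr0 => [|i' /negPf ii']; last first.
  rewrite big1// => b' _; case: eqP; last by rewrite mulr0.
  by move=> /(g_inj gb)[_ E]; rewrite E eqxx in ii'.
rewrite (bigD1_seq b)/= ?iota_uniq ?mem_index_iota ?mb//= gb eqxx mulr1 big1 ?addr0//.
move=> b' /negPf bb'; case: eqP; last by rewrite mulr0.
by move=> /(g_inj gb)[E _]; rewrite E eqxx in bb'.
Qed.

(** The row, its perturbation and [B] are fixed before [t]. Each interval raises the energy by at
    least 1, but the energy never exceeds the sum of the [|B i| ^+ 2]; a chain longer than this sum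
    is contradictory. *)
Theorem row_obstruction :
  (forall t, exists (kappa : nat -> nat) b0,
    [/\ forall j, (j < t)%N -> (s (kappa j) <= b0)%N /\ (s (kappa j) <= s (kappa j.+1))%N,
        (b0 < s (kappa t))%N,
        forall b i, (b < s (kappa t))%N -> g b i <> Some b0 &
        forall j b i, (j < t)%N -> (s (kappa j.+1) <= b < s (kappa t))%N ->
          exists2 c, g b i = Some c & (s (kappa j) <= c)%N]) ->
  ~ rtsr_candidate (nest_algebra N) p.
Proof.
move=> chains /rtsr_candidateP[_ dA]; have [A Ae] := shift_row.
(* With this tolerance the factor [eps ^+ 2 * p%:R] of [row_gain] is at most 1. *)
have eps0 : 0 < p%:R^-1 :> R[i] by rewrite invr_gt0 ltr0n.
have [A' [B [AA AB]]] := dA A _ eps0.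
pose r : R := complex.Re (\sum_i `|B i| ^+ 2).
have rE : r%:C%C = \sum_i `|B i| ^+ 2.
  by rewrite RRe_real// ger0_real// sumr_ge0// => i _; rewrite exprn_ge0.
pose t := (truncn r).+1.
have rt : r < t%:R by exact: truncnS_gt.
have [kappa [b0 [kb b0k gb0 gtot]]] := chains t.
pose x i := B i (e b0); set k := kappa t in b0k gb0 gtot.
have skt j : (j <= t)%N -> (s (kappa j) <= s k)%N.
  move=> jt; rewrite -(subKn jt).
  elim: (t - j)%N (leq_subr j t) => [|d IH] dt; first by rewrite subn0.
  apply: leq_trans (IH (ltnW dt)); rewrite -subSS -/k.
  by have [] := kb (t - d.+1)%N; rewrite ?subnSK//; lia.
have En d : (d <= t)%N -> d%:R <= energy x (s (kappa (t - d)%N)) (s k).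
  elim: d => [_|d IH dt].
    by apply: sumr_ge0 => i _; apply: sumr_ge0 => b _; exact: exprn_ge0.
  have jt : (t - d.+1 < t)%N by lia.
  have jS : (t - d.+1).+1 = (t - d)%N by lia.
  have [jb j01] := kb _ jt.
  have gain := @row_gain p%:R^-1 A A' B (kappa (t - d.+1)%N) (kappa (t - d)%N) k b0
    Ae (ltW eps0) (fun i => ltW (AA i)) AB.
  rewrite -natr1 addrC; apply: le_trans (lerD (lexx 1) (IH (ltnW dt))) _.
  apply: le_trans (gain _ _ gb0 _) _.
  - by rewrite jb b0k.
  - by rewrite -jS j01 skt//; lia.
  - by move=> b i; rewrite -jS => bk; exact: gtot bk.
  have p0 : (p%:R : R[i]) != 0 by rewrite pnatr_eq0 -lt0n.
  have -> : p%:R^-1 ^+ 2 * p%:R = p%:R^-1 :> R[i] by rewrite expr2 -mulrA mulVf// mulr1.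
  rewrite ler_piMl//.
    by apply: sumr_ge0 => i _; apply: sumr_ge0 => b _; exact: exprn_ge0.
  by rewrite invf_le1 ?ler1n// ltr0n.
have := En t (leqnn t); rewrite subnn => tE.
have : t%:R <= r%:C%C.
  apply: le_trans tE _; rewrite rE; apply: ler_sum => i _.
  rewrite (le_trans (bessel (x i) oe (iota_uniq _ _)))//.
  rewrite ler_pXn2r ?nnegrE//.
  by rewrite (le_trans (ler_norm_bop _ _))// (basis_norm b0 oe) mulr1.
by rewrite -(rmorph_nat (real_complex R)) lecR leNgt rt.
Qed.

End RowObstruction.
End RowObstructions.

(** * Rows that exclude rank 1 and, for deep sequences, every finite rank *)

Section DeepNests.
Context {R : realType} {H : hilbertType R}.
Variables (N : omega_nest H) (e : nat -> H) (n : nat -> nat).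
Hypotheses (oe : orthosys xpredT e) (te : total_system e).
Hypothesis n_gt0 : forall k, (0 < n k.+1)%N.
Let s := partial_dim n.
Hypothesis (Ns : forall k, N k = span_upto e (s k)).

Let special b := b == s (block n b).

Let special_s k : special (s k).
Proof.
rewrite /special; suff /eqP -> : block n (s k) == k by [].
by rewrite blockP// leqnn partial_dim_mono_lt/=.
Qed.

(** A shift is used: the first vector of each block goes to that of the preceding block, or to 0 for
    the first block, and all other vectors are fixed. Single blocks serve as intervals. This gives
    the lower bound in the shallow case. *)
Lemma not_rtsr_candidate1 : ~ rtsr_candidate (nest_algebra N) 1.
Proof.
pose g (b : nat) (_ : 'I_1) : option nat :=
  if special b then (if block n b is k.+1 then Some (s k) else None) else Some b.
have sinj := incn_inj (partial_dim_mono n_gt0).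
have gs k i : g (s k.+1) i = Some (s k).
  rewrite /g special_s; suff /eqP -> : block n (s k.+1) == k.+1 by [].
  by rewrite blockP// leqnn partial_dim_mono_lt/=.
have gP b i c : g b i = Some c ->
    (special b /\ exists2 k, b = s k.+1 & c = s k) \/ (~~ special b /\ c = b).
  rewrite /g; case: (boolP (special b)) => [sb|nb [->]]; last by right.
  have bE : b = s (block n b) by exact/eqP.
  by case: (block n b) bE => // k bE [<-]; left; split=> //; exists k.
apply: (row_obstruction oe te Ns (g := g)) => //.
- move=> b i c k /gP[[_ [l -> ->]]|[_ ->//]]; apply: leq_ltn_trans.
  by rewrite partial_dim_mono.
- move=> b b' i i' c /gP[[sb [l bE cE]]|[sb cE]] /gP[[sb' [l' bE' cE']]|[sb' cE']].
  + by rewrite !ord1 bE bE'; split=> //; congr (s _.+1); apply: sinj; exact: etrans (esym cE) cE'.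
  + by rewrite -cE' cE special_s in sb'.
  + by rewrite -cE cE' special_s in sb.
  + by rewrite !ord1 -cE -cE'.
move=> t; exists S, (s t); split.
- by move=> j jt; rewrite !partial_dim_mono// jt.
- by rewrite partial_dim_mono_lt.
- move=> b i bt /gP[[_ [l bE /sinj tl]]|[nb tb]].
    by move: bt; rewrite bE tl ltnn.
  by rewrite -tb special_s in nb.
- move=> j b i jt /andP[jb bt]; case: (boolP (special b)) => [/eqP bE|nb]; last first.
    exists b; first by rewrite /g (negPf nb).
    by apply: leq_trans jb; rewrite partial_dim_mono.
  move: jb; rewrite bE partial_dim_mono//; case: (block n b) => // k jk.
  by exists (s k) => //; rewrite partial_dim_mono.
Qed.

Theorem deep_not_rtsr_candidate p : deep n -> (0 < p)%N -> ~ rtsr_candidate (nest_algebra N) p.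
Proof.
move=> dn p0.
have /choice[F FP] : forall Tk : nat * nat, exists kappa,
    geometric_chain n p Tk.1 kappa /\ (Tk.2 <= kappa 0)%N.
  by move=> [T k]; exact: deep_after.
(* One row must serve every [t], so chains of all lengths are placed in succession: [K T] begins no
   earlier than [K T.-1] ends. *)
pose K := fix K T := if T is T'.+1 then F (T, K T' T) else F (0, 0)%N.
have KP T : geometric_chain n p T (K T).
  by case: T => [|T]; [case: (FP (0, 0)%N)|case: (FP (T.+1, K T T.+1))].
have KS T : (K T T.+1 <= K T.+1 0)%N by case: (FP (T.+1, K T T.+1)).
have Kmono T i j : (i <= j <= T.+1)%N -> (s (K T i) <= s (K T j))%N.
  move=> /andP[ij jT]; rewrite partial_dim_mono//.
  elim: j ij jT => [|j IH]; first by rewrite leqn0 => /eqP ->.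
  rewrite leq_eqVlt => /predU1P[->//|ij jT].
  by apply: leq_trans (IH ij (ltnW jT)) (ltnW ((KP T).1 j _)).
have Klt T T' : (T < T')%N -> (s (K T T.+1) <= s (K T' 0))%N.
  elim: T' => // T' IH; rewrite ltnS leq_eqVlt => /predU1P[->|/IH].
    by rewrite partial_dim_mono.
  move=> /leq_trans; apply; apply: (@leq_trans (s (K T' T'.+1))).
    by apply: Kmono; rewrite leqnn.
  by rewrite partial_dim_mono.
have Kuniq T T' j j' c : (j <= T)%N -> (j' <= T')%N ->
    (s (K T j) <= c < s (K T j.+1))%N -> (s (K T' j') <= c < s (K T' j'.+1))%N ->
    T = T' /\ j = j'.
  wlog TT : T T' j j' / (T <= T')%N.
    move=> W; have [|/ltnW] := leqP T T'; first exact: W.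
    by move=> /W {}W jT jT' h h'; have [] := W _ _ jT' jT h' h.
  move=> jT jT' /andP[h1 h2] /andP[h1' h2'].
  move: TT; rewrite leq_eqVlt => /predU1P[TE|TT]; last first.
    have h3 : (s (K T j.+1) <= s (K T T.+1))%N by apply: Kmono; rewrite ltnS jT leqnn.
    have h4 : (s (K T' 0) <= s (K T' j'))%N by apply: Kmono; rewrite (leqW jT').
    by have := Klt _ _ TT; lia.
  subst T'; split=> //; apply/eqP; rewrite eqn_leq; apply/andP.
  split; rewrite leqNgt; apply/negP => jj.
    have : (s (K T j'.+1) <= s (K T j))%N by apply: Kmono; rewrite jj leqW.
    by lia.
  have : (s (K T j.+1) <= s (K T j'))%N by apply: Kmono; rewrite jj leqW.
  by lia.
(* Here [b] lies in interval [j.+1] of chain [T], and its copies are to be sent into interval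
   [j]. *)
pose link b (Tj : nat * nat) := (Tj.2 < Tj.1)%N /\ (s (K Tj.1 Tj.2.+1) <= b < s (K Tj.1 Tj.2.+2))%N.
(* In base [p], with last digit [i], the number determines both the offset of [b] and [i]; it fits
   into interval [j] because of the ratio [p]. *)
pose val b (i : 'I_p) Tj := (s (K Tj.1 Tj.2) + (p * (b - s (K Tj.1 Tj.2.+1)) + i))%N.
have val_lt b i Tj : link b Tj -> (s (K Tj.1 Tj.2) <= val b i Tj < s (K Tj.1 Tj.2.+1))%N.
  case: Tj => T j [/= jT /andP[jb bj]]; rewrite /val /= leq_addr /=.
  have := (KP T).2 j jT; rewrite -/s => link_le.
  rewrite -ltn_subRL (leq_trans _ link_le)//.
  have : (b - s (K T j.+1) < s (K T j.+2) - s (K T j.+1))%N.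
    by rewrite ltn_sub2r// (leq_ltn_trans jb).
  set x := (b - _)%N; set y := (_ - _)%N => xy.
  rewrite (@leq_trans (p * x.+1))%N// ?leq_mul2l ?xy ?orbT//.
  by rewrite mulnS addnC ltn_add2r ltn_ord.
pose g b i := if pselect (exists Tj, link b Tj) is left ex
  then Some (val b i (sval (cid ex))) else None.
have gP b i c : g b i = Some c -> exists2 Tj, link b Tj & c = val b i Tj.
  by rewrite /g; case: pselect => // ex [<-]; exists (sval (cid ex)) => //; exact: (svalP (cid ex)).
have gE b i Tj : link b Tj -> g b i = Some (val b i Tj).
  move=> bTj; rewrite /g; case: pselect => [ex|[]]; last by exists Tj.
  congr (Some (val b i _)); case: (cid ex) => -[T j] /= [/= jT bj].
  case: Tj bTj => T' j' [/= jT' bj'].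
  by have [-> [->]] := Kuniq T T' j.+1 j'.+1 b jT jT' bj bj'.
apply: (row_obstruction oe te Ns (g := g)) => //.
- move=> b i c k /gP[[T j] bTj ->]; apply: leq_ltn_trans.
  have /andP[_ /ltnW/leq_trans] := val_lt b i _ bTj; apply.
  by case: bTj => _ /andP[].
- move=> b b' i i' c /gP[[T j] bTj cE] /gP[[T' j'] bTj' cE'].
  have := val_lt b i _ bTj; have := val_lt b' i' _ bTj'; rewrite -cE -cE' /= => c' c0.
  have [TT jj] := Kuniq T T' j j' c (ltnW bTj.1) (ltnW bTj'.1) c0 c'.
  move: bTj bTj' cE cE' => [/= jT /andP[jb _]] [/= jT' /andP[jb' _]].
  rewrite /val /= => ->; rewrite -TT -jj in jb' * => /addnI.
  rewrite ![(p * _)%N]mulnC => E.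
  have ii : i = i'.
    apply/val_inj => /=; rewrite -(modn_small (ltn_ord i)) -(modn_small (ltn_ord i')).
    by rewrite -(modnMDl (b - s (K T j.+1))) E modnMDl.
  rewrite ii in E *; move/addIn/eqP: E; rewrite eqn_pmul2r// => /eqP bb; split=> //.
  by rewrite -(subnK jb) bb subnK.
(* The index [b0] is the last one of interval [t]; whatever is sent to it lies in interval [t.+1],
   beyond the range considered. *)
move=> t; pose T := t.+1; exists (fun j => K T j.+1), (s (K T t.+1)).-1.
have Kpos : (0 < s (K T t.+1))%N.
  rewrite (leq_ltn_trans (leq0n (s (K T t))))// partial_dim_mono_lt//.
  by apply: (KP T).1; rewrite /T.
have KltT : (s (K T t) < s (K T t.+1))%N.
  by rewrite partial_dim_mono_lt//; apply: (KP T).1; rewrite /T.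
split.
- move=> j jt; have h1 := Kmono T j.+1 t; have h2 := Kmono T j.+1 j.+2.
  rewrite h2 ?leqnSn//=; last by rewrite /T; lia.
  split=> //; have : (s (K T j.+1) <= s (K T t))%N by apply: h1; rewrite /T; lia.
  by move=> jt'; rewrite -ltnS prednK//; exact: leq_ltn_trans KltT.
- by rewrite ltn_predL.
- move=> b i bt /gP[[T' j'] bTj' b0E].
  have := val_lt b i _ bTj'; rewrite -b0E /= => c0.
  have tT : (t <= T)%N by rewrite /T.
  have t0 : (s (K T t) <= (s (K T t.+1)).-1 < s (K T t.+1))%N.
    by rewrite ltn_predL Kpos andbT -ltnS prednK.
  have /= [TT tj] := Kuniq _ _ _ _ _ tT (ltnW bTj'.1) t0 c0.
  by move: bTj' bt => [/= _ /andP[+ _]]; rewrite -TT -tj leqNgt => /negP.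
- move=> j b i jt /andP[jb bt].
  have [l [jl lt lb]] : exists l,
      [/\ (j.+1 <= l)%N, (l < t)%N & (s (K T l.+1) <= b < s (K T l.+2))%N].
    have : (s (K T t.+1) <= b)%N \/ (b < s (K T t.+1))%N by case: leqP; [left|right].
    case; first by rewrite leqNgt bt.
    have : (t <= t)%N by []; move: {-2}t => u; elim: u => [|u IH] ut bu.
      have : (s (K T 1) <= s (K T j.+2))%N by apply: Kmono; rewrite /T; lia.
      by move=> /(leq_trans bu); rewrite ltnNge jb.
    have [ub|ub] := leqP (s (K T u.+1)) b; last first.
      by have [l [jl lu lb]] := IH (ltnW ut) ub; exists l; split=> //; exact: ltnW.
    exists u; split=> //; last by rewrite ub.
    rewrite ltnNge; apply/negP => uj; have : (s (K T u.+2) <= s (K T j.+2))%N.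
      by apply: Kmono; rewrite /T; lia.
    by move=> /(leq_trans bu); rewrite ltnNge jb.
  have lT : link b (T, l) by split=> //=; rewrite /T; lia.
  exists (val b i (T, l)); first exact: gE.
  have /andP[lv _] := val_lt b i _ lT; apply: leq_trans lv.
  by apply: Kmono; rewrite /T /= jl; lia.
Qed.

End DeepNests.

(** * Shallow sequences: rows of length two *)

Section Choice.
Context {R : realType} {H : hilbertType R}.
Implicit Types (x y z : H).

Lemma unit_vector_seq (n : nat) (u : nat -> H) (T : eqType) (ts : seq T) (f : T -> H -> R[i]) :
  (forall a b, (a < n)%N -> (b < n)%N -> inner (u a) (u b) = (a == b)%:R) ->
  (forall t, linform (f t)) -> (size ts < n)%N ->
  exists c : 'I_n -> R[i], let x := \sum_i c i *: u i in
    inner x x = 1 /\ forall t, t \in ts -> f t x = 0.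
Proof.
move=> ou lf ts_n.
have fu (c : 'I_n -> R[i]) : \sum_i c i *: u i = 0 -> forall i, c i = 0.
  move=> c0 i; have := ip0l (u i); rewrite -c0 ip_suml (bigD1 i)//= ipZl ou// eqxx mulr1.
  rewrite big1 ?addr0// => j /negPf ji; rewrite ipZl ou//.
  by rewrite -[(j : nat) == i]/(j == i) ji mulr0.
have card_ts : (#|[set: 'I_(size ts)]| < n)%N by rewrite cardsT card_ord.
have [c [xx fx]] := unit_vector fu (fun j : 'I_(size ts) => lf (tnth (in_tuple ts) j)) card_ts.
exists c; split=> // t tts; have jts : (index t ts < size ts)%N by rewrite index_mem.
have := fx (Ordinal jts); rewrite inE => /(_ isT).
by rewrite (tnth_nth t) /= nth_index.
Qed.

Variables (e : nat -> H) (n : nat -> nat) (pi : nat -> nat) (r : nat).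
Hypotheses (oe : orthosys xpredT e).
Let s := partial_dim n.
Hypothesis pi_zone : forall k, (0 < k)%N -> (s k - s (pi k) <= r * uphalf (n k))%N.

(* These n k + (n k)./2 indices include those of the basis vectors of atom k and
   of all its descendants. *)
Definition near_block k a := (s k.-1 <= a < s k + (n k)./2)%N.

(* H * H is identified with H by (e_a, 0) |-> e_{2a} and (0, e_a) |-> e_{2a+1}, so
   this is two copies of atom k. *)
Definition double_block k : set H :=
  [set x | span_upto e (2 * s k) x /\ forall c, (c < 2 * s k.-1)%N -> inner x (e c) = 0].

(** [u] lists the vectors used for earlier classes. The new ones are chosen by increasing [a], each
    orthogonal to its predecessors; symmetry supplies the other half of the orthogonality. *)
Lemma double_block_vectors (k i : nat) (u : nat -> H) (F : bounded_operator H) : (0 < k)%N ->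
  exists w : nat -> H, forall a, near_block k a -> (a %% r = i)%N ->
    [/\ inner (w a) (w a) = 1, double_block k (w a),
        forall c, (c %% r = i)%N -> (s (pi k) <= c < s k)%N -> inner (F (w a)) (e c) = 0,
        forall b, near_block k b -> (b %% r < i)%N -> inner (w a) (u b) = 0 &
        forall b, near_block k b -> (b %% r = i)%N -> b <> a -> inner (w a) (w b) = 0].
Proof.
move=> k0.
(* Of the 2 n_k dimensions, at most n_k + n_k / 2 - 1 are lost to orthogonality
   and at most uphalf n_k to the conditions on the image. *)
pose good (w : nat -> H) a := [/\ inner (w a) (w a) = 1, double_block k (w a),
        forall c, (c %% r = i)%N -> (s (pi k) <= c < s k)%N -> inner (F (w a)) (e c) = 0,
        forall b, near_block k b -> (b %% r < i)%N -> inner (w a) (u b) = 0 &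
        forall b, near_block k b -> (b %% r = i)%N -> (b < a)%N -> inner (w a) (w b) = 0].
suff [w wP] : exists w, forall a, (a < s k + (n k)./2)%N ->
    near_block k a -> (a %% r = i)%N -> good w a.
  exists w => a Ia ai; have [//|w1 w2 w3 w4 w5] := wP a _ Ia ai; first by case/andP: Ia.
  split=> // b Ib bi ba; have [ba'|ab|//] := ltngtP b a; first exact: w5.
  by apply: ip_eq0C; have [//|_ _ _ _] := wP b _ Ib bi; [case/andP: Ib|apply].
elim: (s k + (n k)./2)%N => [|m [w wP]]; first by exists (fun=> 0).
case: (boolP (near_block k m && (m %% r == i)%N)) => [/andP[Im /eqP mi]|nm]; last first.
  exists w => a; rewrite ltnS leq_eqVlt => /predU1P[->|/wP//] Im mi.
  by rewrite Im mi eqxx in nm.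
(* Left tags stand for orthogonality to earlier vectors, right tags for vanishing entries of the
   image. Leaving out [m] itself makes the count strict. *)
pose ts := map inl [seq b <- index_iota (s k.-1) (s k + (n k)./2) |
                     (b != m) && ((b %% r < i) || ((b %% r == i) && (b < m)))%N] ++
           map inr [seq c <- index_iota (s (pi k)) (s k) | (c %% r == i)%N] : seq (nat + nat).
pose f (t : nat + nat) x := match t with
  | inl b => inner x (if (b %% r < i)%N then u b else w b)
  | inr c => inner (F x) (e c)
  end.
have lf t : linform (f t).
  by case: t => [b|c] a x y; rewrite /f ?bopD ?bopZ ?ipDl ?ipZl.
have nE : (s k.-1 + n k = s k)%N by case: (k) k0 => // l _; rewrite /s partial_dimS.
have ts_lt : (size ts < 2 * n k)%N.
  rewrite size_cat !size_map !size_filter.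
  have c1 := @count_residue r i (s (pi k)) _ _ (pi_zone k0).
  rewrite -/(index_iota _ _) in c1.
  have c2 : (count (fun b => (b != m) && ((b %% r < i) || ((b %% r == i) && (b < m)))%N)
      (index_iota (s k.-1) (s k + (n k)./2)) < n k + (n k)./2)%N.
    have -> : (n k + (n k)./2 = size (index_iota (s k.-1) (s k + (n k)./2)))%N.
      by rewrite size_iota; lia.
    rewrite ltn_neqAle count_size andbT -all_count; apply/allPn; exists m.
      by rewrite mem_index_iota.
    by rewrite eqxx.
  have := uphalf_half (n k); have := odd_double_half (n k); lia.
have oblock a b : (a < 2 * n k)%N -> (b < 2 * n k)%N ->
    inner (e (2 * s k.-1 + a)%N) (e (2 * s k.-1 + b)%N) = (a == b)%:R.
  by move=> _ _; rewrite ip_basis// eqn_add2l.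
have [c [xx fx]] := unit_vector_seq oblock lf ts_lt.
set x := (\sum_i _) in xx fx.
have fxl b : near_block k b -> (b %% r < i)%N -> inner x (u b) = 0.
  rewrite /near_block => Ib bi; have : inl b \in ts.
    rewrite mem_cat map_f// mem_filter mem_index_iota bi Ib orTb !andbT.
    by apply: contraTneq bi => ->; rewrite mi ltnn.
  by move=> /fx; rewrite /f bi.
have fxn b : near_block k b -> (b %% r = i)%N -> (b < m)%N -> inner x (w b) = 0.
  rewrite /near_block => Ib bi bm; have : inl b \in ts.
    by rewrite mem_cat map_f// mem_filter mem_index_iota bi eqxx bm Ib orbT !andbT ltn_eqF.
  by move=> /fx; rewrite /f bi ltnn.
have fxr b : (b %% r = i)%N -> (s (pi k) <= b < s k)%N -> inner (F x) (e b) = 0.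
  move=> bi Ib; have : inr b \in ts.
    by rewrite mem_cat [X in _ || X]map_f ?orbT// mem_filter mem_index_iota bi eqxx.
  by move=> /fx.
have xK : double_block k x.
  split=> [b kb|b bk]; rewrite ip_suml big1// => j _; rewrite ipZl ip_basis//.
    by rewrite ltn_eqF ?mulr0// (leq_trans _ kb)// -nE mulnDr ltn_add2l.
  by rewrite gtn_eqF ?mulr0// (leq_trans bk)// leq_addr.
exists (fun a => if a == m then x else w a) => a; rewrite ltnS leq_eqVlt => /predU1P[->|am] Ia ai.
  rewrite /good eqxx; split=> // b Ib bi bm; rewrite ltn_eqF//; exact: fxn.
have [w1 w2 w3 w4 w5] := wP a am Ia ai.
rewrite /good ltn_eqF//; split=> // b Ib bi ba.
by rewrite ltn_eqF ?(ltn_trans ba)//; exact: w5.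
Qed.

End Choice.

(** * Solving the equation one residue class at a time *)

Section Elimination.
Context {R : realType} {H : hilbertType R}.
Variables (e : nat -> H) (n pi : nat -> nat) (r L : nat).
Hypotheses (oe : orthosys xpredT e) (te : total_system e).
Hypothesis n_gt0 : forall k, (0 < n k.+1)%N.
Let s := partial_dim n.
Hypothesis pi0 : pi 0 = 0%N.
Hypothesis pi_lt : forall k, (0 < k)%N -> (pi k < k)%N.
Hypothesis pi_zone : forall k, (0 < k)%N -> (s k - s (pi k) <= r * uphalf (n k))%N.
Hypothesis pi_depth : forall k, iter L.+1 pi k = 0%N.
Let I := near_block n.
Let anc t a := iter t pi (block n a).+1.
Hypothesis anc_near : forall t a, (0 < anc t a)%N -> I (anc t a) a.
Implicit Types (x y z : H) (A B T : bounded_operator H).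

Definition maps_filtration (f g : nat -> nat) T :=
  forall k x, span_upto e (f k) x -> span_upto e (g k) (T x).

Let s2 k := (2 * s k)%N.

Lemma maps_filtration_basis f g T :
  (forall k a, (a < f k)%N -> span_upto e (g k) (T (e a))) -> maps_filtration f g T.
Proof. by move=> Te k x; apply: span_upto_map => // a; exact: Te. Qed.

Lemma anc_le t a : (anc t.+1 a <= anc t a)%N.
Proof. by rewrite /anc iterS; case: (iter t _ _) => [|k]; rewrite ?pi0// ltnW// pi_lt. Qed.

Lemma anc_lt t t' a : (t < t')%N -> (0 < anc t a)%N -> (anc t' a < anc t a)%N.
Proof.
move=> tt a0; elim: t' tt => // t' IH; rewrite ltnS leq_eqVlt => /predU1P[<-|/IH].
  by rewrite /anc iterS pi_lt.
exact: leq_ltn_trans (anc_le _ _).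
Qed.

Lemma anc_block t a : (anc t a <= (block n a).+1)%N.
Proof. by elim: t => // t; apply: leq_trans; exact: anc_le. Qed.

Lemma double_block_ip k k' x y : (k < k')%N -> double_block e n k x -> double_block e n k' y ->
  inner x y = 0.
Proof.
move=> kk [xk _] [_ yk]; rewrite (span_expand oe te xk) ip_suml big1// => c _.
rewrite ipZl (ip_eq0C (yk _ _)) ?mulr0// (leq_trans (ltn_ord c))//.
by rewrite leq_mul2l partial_dim_le// -ltnS prednK// (leq_trans _ kk).
Qed.

Lemma double_block_far k k' x y : (k < k')%N -> span_upto e (s2 k) x -> double_block e n k' y ->
  inner x y = 0.
Proof.
move=> kk xk [_ yk]; rewrite (span_expand oe te xk) ip_suml big1// => c _.
rewrite ipZl (ip_eq0C (yk _ _)) ?mulr0// (leq_trans (ltn_ord c))//.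
by rewrite leq_mul2l partial_dim_le// -ltnS prednK// (leq_trans _ kk).
Qed.

(* A B = 1 on the classes below i; the range of B is spanned by the vectors v k a,
   which are no longer available in later steps. *)
Definition eliminated i A B (v : nat -> nat -> H) :=
  [/\ maps_filtration s2 s A /\ maps_filtration s s2 B,
      forall a, (i <= a %% r)%N -> B (e a) = 0,
      forall a c, (a %% r < i)%N -> (c %% r < i)%N -> inner (A (B (e a))) (e c) = (a == c)%:R,
      forall k a, (0 < k)%N -> I k a -> (a %% r < i)%N -> double_block e n k (v k a) &
      forall x, (forall k a, (0 < k)%N -> I k a -> (a %% r < i)%N -> inner x (v k a) = 0) ->
        forall b, inner (B (e b)) x = 0].

(** [A] is perturbed by a small [P] so that some [X] inverts [A + P] on class [i] without producing
    entries in lower classes; [B] is then corrected by [X]. *)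
Lemma elimination_step i A B v (d : R[i]) : eliminated i A B v -> 0 < d ->
  exists A' B' v', `|A' - A| <= d /\ eliminated i.+1 A' B' v'.
Proof.
move=> [[triA triB] B0 AB vK vB] d0.
have e_span a k : (a < s k)%N -> span_upto e (s k) (e a) by exact: span_upto_basis.
have ABy k y c : span_upto e (s k) y -> (c %% r < i)%N -> inner (A (B y)) (e c) = inner y (e c).
  move=> /(span_expand oe te) -> ci; rewrite !bop_comb !ip_suml; apply: eq_bigr => a _.
  rewrite !ipZl ip_basis//; congr (_ * _); have [ai|ai] := ltnP (a %% r) i; first exact: AB.
  by rewrite B0// bop0 ip0l; case: eqP => // ac; move: ai; rewrite ac leqNgt ci.
have oi : orthosys (fun a => a %% r == i)%N (fun a => if (a %% r == i)%N then e a else 0).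
  move=> a b; case: ifP => ai; last by rewrite ip0l andbF.
  case: ifP => bi; first by rewrite ip_basis// andbT.
  by rewrite ip0r; case: eqP => // ab; rewrite ab bi in ai.
have [Pi [Pie _]] := diagop_basis oe oi.
have Pi_ip k y c : span_upto e (s k) y -> inner (Pi y) (e c) = (c %% r == i)%N%:R * inner y (e c).
  move=> /(span_expand oe te) ->; rewrite bop_comb !ip_suml mulr_sumr; apply: eq_bigr => a _.
  rewrite !ipZl mulrCA; congr (_ * _); rewrite Pie ip_basis//.
  have [<-|/negPf ac] := eqVneq (a : nat) c.
    by rewrite mulr1; case: ifP => _; rewrite ?ip_basis ?ip0l ?eqxx.
  by rewrite mulr0; case: ifP => _; rewrite ?ip_basis ?ac ?ip0l.
have triPi : maps_filtration s s Pi.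
  by move=> k x xk c kc; rewrite (Pi_ip k)// xk// mulr0.
(* [E] removes what [B] already solves: [A E] has no entries in classes below [i], and [F] is its
   part in class [i]. *)
have [E Ex] : exists E : bounded_operator H, forall x, E x = x - B (A x).
  by exists (bop_one H - bop_mul B A).
have triE : maps_filtration s2 s2 E.
  move=> k x xk; rewrite Ex -[x]scale1r -scaleN1r addrC.
  by apply: span_uptoD; rewrite ?scale1r//; apply: triB; exact: triA.
have [F Fx] : exists F : bounded_operator H, forall x, F x = Pi (A (E x)).
  by exists (bop_mul Pi (bop_mul A E)).
have triF : maps_filtration s2 s F.
  by move=> k x xk; rewrite Fx; apply: triPi; apply: triA; exact: triE.
have /choice[w wP] : forall k, exists w : nat -> H, (0 < k)%N ->
    forall a, I k a -> (a %% r = i)%N ->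
    [/\ inner (w a) (w a) = 1, double_block e n k (w a),
        forall c, (c %% r = i)%N -> (s (pi k) <= c < s k)%N -> inner (F (w a)) (e c) = 0,
        forall b, I k b -> (b %% r < i)%N -> inner (w a) (v k b) = 0 &
        forall b, I k b -> (b %% r = i)%N -> b <> a -> inner (w a) (w b) = 0].
  case=> [|k]; first by exists (fun=> 0).
  have [w wP] := double_block_vectors oe pi_zone i (v k.+1) F (ltn0Sn k).
  by exists w => _.
pose act t a := ((a %% r == i) && (0 < anc t a))%N.
pose u t a := if act t a then w (anc t a) a else 0.
have uP t a : act t a -> [/\ inner (u t a) (u t a) = 1, double_block e n (anc t a) (u t a),
    forall c, (c %% r = i)%N -> (s (anc t.+1 a) <= c < s (anc t a))%N ->
      inner (F (u t a)) (e c) = 0 &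
    forall b, I (anc t a) b -> (b %% r < i)%N -> inner (u t a) (v (anc t a) b) = 0].
  move=> /[dup] ta; rewrite /u => -> ; have /andP[/eqP ai a0] := ta.
  by have [h1 h2 h3 h4 _] := wP _ a0 a (anc_near a0) ai; split.
(* Different ancestors have orthogonal double blocks. At a common ancestor the choice of [w]
   applies, since the positive ancestors of one index are distinct. *)
have u_orth t t' a b : (t, a) <> (t', b) -> inner (u t a) (u t' b) = 0.
  move=> tatb; rewrite /u; case: ifP => ta; last by rewrite ip0l.
  case: ifP => tb; last by rewrite ip0r.
  have /andP[/eqP ai a0] := ta; have /andP[/eqP bi b0] := tb.
  have [wa wa2 _ _ wao] := wP _ a0 a (anc_near a0) ai.
  have [wb wb2 _ _ _] := wP _ b0 b (anc_near b0) bi.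
  have [kk|kk|kk] := ltngtP (anc t a) (anc t' b).
  - exact: double_block_ip kk wa2 wb2.
  - by apply: ip_eq0C; exact: double_block_ip kk wb2 wa2.
  rewrite -kk; apply: wao => //; first by rewrite kk; exact: anc_near.
  move=> ba; apply: tatb; rewrite ba in kk *; congr (_, _).
  have [tt|tt|//] := ltngtP t t'.
    by have := anc_lt tt a0; rewrite kk ltnn.
  by rewrite ba in b0; have := anc_lt tt b0; rewrite -kk ltnn.
have ou t : orthosys (act t) (u t).
  move=> a b; have [<-|ab] := eqVneq a b; last by rewrite u_orth// => -[] /eqP; rewrite (negPf ab).
  rewrite /= {1}/u; case: (boolP (act t a)) => ta; last by rewrite ip0l.
  by have [+ _ _ _] := uP t a ta; rewrite {1}/u ta.
(* An index near atom [l] is below [s l + n l <= 2 * s l], so [s2 k <= a] forces each positive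
   ancestor of [a] beyond [k]. *)
have u_far t a k x : (s2 k <= a)%N -> span_upto e (s2 k) x -> inner x (u t a) = 0.
  move=> ka xk; rewrite /u; case: ifP => ta; last by rewrite ip0r.
  have [_ +  _ _] := uP t a ta; rewrite /u ta => wK.
  have /andP[_ a0] := ta; apply: double_block_far xk wK.
  have /andP[_ aI] := anc_near a0; rewrite ltnNge; apply/negP => ak.
  have sK : (s (anc t a) <= s k)%N by exact: partial_dim_le.
  have nK : (n (anc t a) <= s (anc t a))%N.
    by case: (anc t a) a0 => // l _; rewrite /s partial_dimS leq_addl.
  have hK : ((n (anc t a))./2 <= n (anc t a))%N by rewrite -divn2 leq_div.
  by move: ka; rewrite /s2 -/s in aI *; lia.
have u_low t a k x : span_upto e (s2 k) x -> inner x (u t a) = 0 \/ (act t a /\ (anc t a <= k)%N).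
  move=> xk; case: (boolP (act t a)) => ta; last by left; rewrite /u (negPf ta) ip0r.
  have [ak|ka] := leqP (anc t a) k; [by right|left].
  by have [_ wK _ _] := uP t a ta; exact: double_block_far ka xk wK.
have u_span t a : span_upto e (s2 (anc t a)) (u t a).
  case: (boolP (act t a)) => ta; first by have [_ []] := uP t a ta.
  by rewrite /u (negPf ta) => b _; rewrite ip0l.
have [D De] : exists D : nat -> bounded_operator H, forall t a, D t (e a) = u t a.
  exists (fun t => projT1 (diagop_basis oe (ou t))) => t a.
  by have [+ _] := projT2 (diagop_basis oe (ou t)); apply.
(* [G t] is the adjoint of [D t]: it recovers [e a] from a nonzero [u t a]. *)
have [G Gx] : exists G : nat -> bounded_operator H, forall t k x, span_upto e (s2 k) x ->
    G t x = \sum_(a < s2 k) inner x (u t a) *: e a.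
  exists (fun t => projT1 (diagop_ex (ou t) oe)) => t k x xk.
  have [+ _] := projT2 (diagop_ex (ou t) oe); apply => a ka.
  exact: u_far ka xk.
have Gu t t' a : G t (u t' a) = if (t == t') && act t' a then e a else 0.
  case: (boolP (act t' a)) => ta; last by rewrite /u (negPf ta) bop0 andbF.
  rewrite (Gx t _ _ (u_span t' a)) andbT; have [uu _ _ _] := uP t' a ta.
  case: eqP => [->|tt]; last first.
    by rewrite big1// => b _; rewrite u_orth ?scale0r// => -[E' _]; rewrite E' in tt.
  have aK : (a < s2 (anc t' a))%N.
    rewrite ltnNge; apply/negP => Ka; have := u_far t' a _ _ Ka (u_span t' a).
    by rewrite uu => /eqP; rewrite oner_eq0.
  rewrite (bigD1 (Ordinal aK))//= uu scale1r big1 ?addr0// => b /negPf ba.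
  rewrite u_orth ?scale0r// => -[ab]; move: ba; rewrite -val_eqE /= -ab eqxx.
  by [].
have uv t a k' b : act t a -> (0 < k')%N -> I k' b -> (b %% r < i)%N -> inner (u t a) (v k' b) = 0.
  move=> ta k0 Ib bi; have [_ wK _ wv] := uP t a ta; have vbK := vK _ _ k0 Ib bi.
  have [kk|kk|kk] := ltngtP (anc t a) k'; last by rewrite -kk; apply: wv; rewrite // kk.
    exact: double_block_ip kk wK vbK.
  by apply: ip_eq0C; exact: double_block_ip kk vbK wK.
(* The vectors [u t a] are orthogonal to the [v k b] of lower classes, hence to the range of [B]; a
   perturbation built from [G] leaves [A B] unchanged. *)
have GB t k y : span_upto e (s k) y -> G t (B y) = 0.
  move=> yk; rewrite (Gx t k _ (triB _ _ yk)) big1// => a _.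
  rewrite [X in X *: _](_ : _ = 0) ?scale0r//.
  case: (boolP (act t a)) => ta; last by rewrite /u (negPf ta) ip0r.
  rewrite (span_expand oe te yk) bop_comb ip_suml big1// => b _.
  by rewrite ipZl vB ?mulr0// => k' a' *; exact: uv.
have F_row k x c : span_upto e (s2 k) x -> (c %% r != i)%N -> inner (F x) (e c) = 0.
  move=> xk /negPf ci; rewrite Fx (Pi_ip k) ?ci ?mul0r//.
  by apply: triA; exact: triE.
(* The image has no entries in the zone between two successive ancestors, so it drops to the next
   one. This makes [Q] triangular, and nothing is left at the root. *)
have Fu_span t a : span_upto e (s (anc t.+1 a)) (F (u t a)).
  case: (boolP (act t a)) => ta; last by rewrite /u (negPf ta) bop0 => b _; rewrite ip0l.
  have [_ _ wz _] := uP t a ta => c c1.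
  have [c2|c2] := ltnP c (s (anc t a)); last by apply: (triF _ _ (u_span t a)).
  have [ci|ci] := eqVneq (c %% r)%N i; first by apply: wz => //; rewrite c1.
  exact: F_row (u_span t a) ci.
have Fu0 t a : anc t.+1 a = 0%N -> F (u t a) = 0.
  move=> a0; apply: te => c; apply: (Fu_span t a); rewrite a0.
  by rewrite /s /partial_dim big_ord0.
have [M ME] : exists M : nat -> bounded_operator H, forall t x, M t x = F (D t (G t.+1 x)).
  by exists (fun t => bop_mul (bop_mul F (D t)) (G t.+1)).
have Mx t k x : span_upto e (s2 k) x ->
    M t x = \sum_(a < s2 k) inner x (u t.+1 a) *: F (u t a).
  by move=> xk; rewrite ME (Gx _ _ _ xk) 2!bop_comb; apply: eq_bigr => a _; rewrite De.
have Mu t t' a : M t (u t' a) = if (t' == t.+1) && act t' a then F (u t a) else 0.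
  by rewrite ME Gu eq_sym; case: ifP => _; rewrite ?De// !bop0.
(* F + c Q sends u 0 a to c e_a + F (u 0 a) and u t.+1 a to
   F (u t.+1 a) - c F (u t a), which telescopes with the weights c ^- t. *)
have [Q Qx] : exists Q : bounded_operator H, forall x, Q x = G 0%N x - \sum_(t < L.+1) M t x.
  by exists (G 0%N - \sum_(t < L.+1) M t) => x; rewrite -bop_sum.
have triQ : maps_filtration s2 s Q.
  move=> k x xk; rewrite Qx; apply: span_uptoB.
    rewrite (Gx _ _ _ xk); apply: span_upto_sum => a _.
    case: (u_low 0%N a k x xk) => [|[_ ak]]; [by left|right].
    by apply: e_span; rewrite block_lt.
  apply: span_upto_sum1 => t _; rewrite (Mx _ _ _ xk).
  apply: span_upto_sum => a _; case: (u_low t.+1 a k x xk) => [|[_ ak]]; [by left|right].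
  by apply: span_upto_le (Fu_span t a); exact: partial_dim_le.
have Q_row k x c : span_upto e (s2 k) x -> (c %% r != i)%N -> inner (Q x) (e c) = 0.
  move=> xk ci; rewrite Qx ipBl (Gx _ _ _ xk) !ip_suml !big1 ?subr0// => [t _|a _].
    rewrite (Mx _ _ _ xk) ip_suml big1// => a _.
    by rewrite ipZl (F_row _ _ _ (u_span t a) ci) mulr0.
  rewrite ipZl; case: (u_low 0%N a k x xk) => [->|[/andP[ai _] _]]; first by rewrite mul0r.
  by rewrite ip_basis//; case: eqP => [ac|]; [rewrite -ac ai in ci|rewrite mulr0].
have QB k y : span_upto e (s k) y -> Q (B y) = 0.
  move=> yk; rewrite Qx (GB _ _ _ yk) sub0r big1 ?oppr0// => t _.
  by rewrite ME (GB _ _ _ yk) !bop0.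
have Qu0 a : (a %% r = i)%N -> Q (u 0%N a) = e a.
  move=> ai; have ta : act 0%N a by rewrite /act ai eqxx.
  have -> : Q (u 0%N a) = e a - 0; last by rewrite subr0.
  by rewrite Qx; congr (_ - _); [rewrite Gu ta|rewrite big1// => t _; rewrite Mu].
have QuS t a : (t < L)%N -> (a %% r = i)%N -> Q (u t.+1 a) = - F (u t a).
  have Gu0 : G 0%N (u t.+1 a) = 0 by rewrite Gu.
  move=> tL ai; rewrite Qx Gu0 sub0r (bigD1 (Ordinal (leqW tL)))//= big1 ?addr0 => [|t' /negPf tt].
    rewrite Mu eqxx andTb; case: (boolP (act t.+1 a)) => // ta.
    suff a0 : anc t.+1 a = 0%N by rewrite Fu0.
    by apply/eqP; rewrite eqn0Ngt; apply: contra ta => ta; rewrite /act ai eqxx.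
  by rewrite Mu eqSS eq_sym -[_ == _]/(t' == Ordinal (leqW tL)) tt.
have Q10 : 0 < `|Q| + 1 by rewrite ltr_wpDl.
pose c := d / (`|Q| + 1).
have c0 : 0 < c by rewrite divr_gt0.
have cn0 : c != 0 by rewrite gt_eqF.
pose P := c *: Q.
have Px x : P x = c *: Q x by [].
have P_norm : `|P| <= d.
  rewrite normrZ (gtr0_norm c0) /c -mulrA ler_piMr// ?(ltW d0)//.
  by rewrite ler_pdivrMl// mulr1 lerDl.
have [Bt Btx] : exists Bt : bounded_operator H, forall x, Bt x = \sum_(t < L.+1) c ^- t *: D t x.
  by exists (\sum_(t < L.+1) c ^- t *: D t) => x; rewrite bop_sum.
have Bt_span a : span_upto e (s2 (block n a).+1) (Bt (e a)).
  rewrite Btx; apply: span_upto_sum1 => t _; apply: span_uptoZ; rewrite De.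
  apply: span_upto_le (u_span t a); rewrite leq_mul2l partial_dim_le//.
  exact: anc_block.
(* At the ends of the telescoping sum, [F (u L a)] is 0 because [anc L.+1 a] is 0, and [P (u 0 a)]
   is [c *: e a]. *)
have FPBt a : (a %% r = i)%N -> F (Bt (e a)) + P (Bt (e a)) = c *: e a.
  move=> ai; rewrite Px Btx !bop_comb.
  under eq_bigr do rewrite De.
  under [X in _ + _ *: X]eq_bigr do rewrite De.
  rewrite big_ord_recr [X in _ + _ *: X]big_ord_recl /=.
  rewrite Fu0 ?scaler0 ?addr0; last first.
    by rewrite -(pi_depth (block n a).+1).
  rewrite expr0 invr1 scale1r Qu0// scalerDr addrC -addrA scaler_sumr.
  rewrite [X in _ + (X + _)](_ : _ = - \sum_(t < L) c ^- t *: F (u t a)) ?addNr ?addr0//.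
  rewrite -sumrN; apply: eq_bigr => t _.
  by rewrite QuS// scalerN scalerN scalerA exprS invfM mulrA mulfV// mul1r.
have [X Xx] : exists X : bounded_operator H, forall x, X x = c^-1 *: E (Bt x).
  by exists (c^-1 *: bop_mul E Bt).
have X0 a : (a %% r != i)%N -> X (e a) = 0.
  move=> /negPf ai; rewrite Xx Btx big1 ?bop0 ?scaler0// => t _.
  by rewrite De /u /act ai scaler0.
have triX : maps_filtration s s2 X.
  apply: maps_filtration_basis => k a; rewrite block_lt// => ak; rewrite Xx; apply: span_uptoZ.
  apply: triE; apply: span_upto_le (Bt_span a).
  by rewrite leq_mul2l partial_dim_le.
have AE_lt k y b : span_upto e (s2 k) y -> (b %% r < i)%N -> inner (A (E y)) (e b) = 0.
  by move=> yk bi; rewrite Ex bopB ipBl (ABy k) ?subrr//; exact: triA.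
have AE_eq k y b : span_upto e (s2 k) y -> (b %% r = i)%N ->
    inner (A (E y)) (e b) = inner (F y) (e b).
  move=> yk bi; rewrite Fx (Pi_ip k) ?bi ?eqxx ?mul1r//.
  by apply: triA; exact: triE.
have PE k y : span_upto e (s2 k) y -> P (E y) = P y.
  by move=> yk; rewrite Ex bopB [P (B _)]Px (QB k) ?scaler0 ?subr0//; exact: triA.
have [A' A'x] : exists2 A' : bounded_operator H, forall x, A' x = A x + P x & `|A' - A| <= d.
  by exists (A + P) => //; rewrite addrC addKr.
have triA' : maps_filtration s2 s A'.
  by move=> k x xk; rewrite A'x Px; apply: span_upto_add; [exact: triA|apply: span_uptoZ; exact: triQ].
have A'_lt k y b : span_upto e (s2 k) y -> (b %% r < i)%N -> inner (A' y) (e b) = inner (A y) (e b).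
  move=> yk bi; rewrite A'x ipDl Px ipZl (Q_row k) ?mulr0 ?addr0//.
  by rewrite ltn_eqF.
move=> A'A.
have AX a b : (a %% r = i)%N -> (b %% r <= i)%N -> inner (A' (X (e a))) (e b) = (a == b)%:R.
  move=> ai; rewrite A'x Xx !bopZ -scalerDr ipZl (PE _ _ (Bt_span a)) ipDl leq_eqVlt.
  move=> /predU1P[bi|bi].
    rewrite (AE_eq _ _ _ (Bt_span a) bi) -ipDl FPBt// ipZl ip_basis//.
    by rewrite mulrA mulVf// mul1r.
  rewrite (AE_lt _ _ _ (Bt_span a) bi) add0r Px ipZl (Q_row _ _ _ (Bt_span a)).
    by rewrite !mulr0; case: eqP => // ab; rewrite -ab ai ltnn in bi.
  by rewrite ltn_eqF.
have AXy k y b : span_upto e (s k) y -> (b %% r <= i)%N ->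
    inner (A' (X y)) (e b) = (b %% r == i)%N%:R * inner y (e b).
  move=> /(span_expand oe te) -> bi; rewrite !bop_comb !ip_suml mulr_sumr.
  apply: eq_bigr => a _; rewrite !ipZl ip_basis// mulrCA; congr (_ * _).
  have [ai|ai] := eqVneq (a %% r)%N i.
    rewrite AX//; case: eqP => [<-|_]; last by rewrite mulr0.
    by rewrite ai eqxx mul1r.
  rewrite X0// bop0 ip0l; have [<-|_] := eqVneq (a : nat) b; last by rewrite mulr0.
  by rewrite (negPf ai) mul0r.
(* Adding [X] solves class [i]; subtracting [X A' B] clears the entries of [A' B] in the rows of
   class [i]. *)
have [B' B'x] : exists B' : bounded_operator H, forall x, B' x = B x + X x - X (A' (B x)).
  by exists (B + X - bop_mul X (bop_mul A' B)).
exists A', B', (fun k a => if (a %% r == i)%N then w k a else v k a); split=> //.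
split.
- split=> // k x xk; rewrite B'x; apply: span_uptoB.
    by apply: span_upto_add; [exact: triB|exact: triX].
  by apply: triX; apply: triA'; exact: triB.
- move=> a ia; rewrite B'x B0 ?(ltnW ia)// X0 ?gtn_eqF// !bop0.
  by rewrite addr0 subr0.
- move=> a b; rewrite !ltnS => ai bi; rewrite B'x bopB bopD ipBl ipDl.
  have ak : span_upto e (s (block n a).+1) (e a) by apply: e_span; rewrite block_lt.
  rewrite (AXy _ _ _ ak bi) (AXy (block n a).+1)//; last by apply: triA'; exact: triB.
  rewrite ip_basis//; move: bi; rewrite leq_eqVlt => /predU1P[bi|bi].
    by rewrite bi eqxx !mul1r addrC addKr.
  rewrite ltn_eqF// !mul0r addr0 subr0 (A'_lt _ _ _ (triB _ _ ak) bi).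
  move: ai; rewrite leq_eqVlt => /predU1P[ai|ai]; last exact: AB.
  rewrite B0 ?ai// bop0 ip0l; case: eqP => // ab; by rewrite -ab ai ltnn in bi.
- move=> k a k0 Ia; rewrite ltnS leq_eqVlt => /predU1P[ai|ai].
    by rewrite ai eqxx; have [] := wP k k0 a Ia ai.
  by rewrite ltn_eqF//; exact: vK.
move=> x xv b.
have xv' k a : (0 < k)%N -> I k a -> (a %% r < i)%N -> inner x (v k a) = 0.
  by move=> k0 Ia ai; have := xv k a k0 Ia (ltnW ai); rewrite ltn_eqF.
have By0 k y : span_upto e (s k) y -> inner (B y) x = 0.
  move=> /(span_expand oe te) ->; rewrite bop_comb ip_suml big1// => a _.
  by rewrite ipZl vB ?mulr0.
have ux t a : inner (u t a) x = 0.
  rewrite /u; case: ifP => // [/andP[/eqP ai a0]|_]; last by rewrite ip0l.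
  apply: ip_eq0C; have := xv (anc t a) a a0 (anc_near a0).
  by rewrite ai ltnSn eqxx; exact.
have Xa a : inner (X (e a)) x = 0.
  rewrite Xx Ex ipZl ipBl (By0 (block n a).+1) ?subr0; last exact: triA (Bt_span a).
  rewrite Btx ip_suml big1 ?mulr0// => t _.
  by rewrite ipZl De ux mulr0.
have Xy0 k y : span_upto e (s k) y -> inner (X y) x = 0.
  move=> /(span_expand oe te) ->; rewrite bop_comb ip_suml big1// => a _.
  by rewrite ipZl Xa mulr0.
have bk : span_upto e (s (block n b).+1) (e b) by apply: e_span; rewrite block_lt.
rewrite B'x ipBl ipDl (By0 _ _ bk) Xa (Xy0 (block n b).+1) ?subr0 ?addr0//.
by apply: triA'; exact: triB.
Qed.

(** Start from [B = 0], with no class solved, and spend [d / r] on each of the [r] classes. *)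
Theorem elimination A (d : R[i]) : (0 < r)%N -> maps_filtration s2 s A -> 0 < d ->
  exists A' B, [/\ `|A' - A| <= d, maps_filtration s2 s A', maps_filtration s s2 B &
    forall a, A' (B (e a)) = e a].
Proof.
move=> r0 triA d0.
have step i : exists A' B v, `|A' - A| <= i%:R * (d / r%:R) /\ eliminated i A' B v.
  elim: i => [|i [A' [B [v [A'A elA']]]]].
    exists A, 0, (fun _ _ => 0); split; first by rewrite subrr normr0 mul0r.
    by split=> // [|x _ b]; [split=> // k x _ b _; rewrite ip0l|rewrite ip0l].
  have dr : 0 < d / r%:R by rewrite divr_gt0// ltr0n.
  have [A'' [B' [v' [A''A' elA'']]]] := elimination_step elA' dr.
  exists A'', B', v'; split=> //; rewrite -[A'' - A](subrKA A').
  by rewrite (le_trans (ler_normD _ _))// -natr1 mulrDl mul1r [leRHS]addrC lerD.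
have [A' [B [v [A'A [[tA tB] _ AB _ _]]]]] := step r.
exists A', B; split=> //.
  have rn0 : (r%:R : R[i]) != 0 by rewrite pnatr_eq0 -lt0n.
  by move: A'A; rewrite mulrC divfK.
move=> a; apply/eqP; rewrite -subr_eq0; apply/eqP/te => b.
by rewrite ipBl AB ?ltn_pmod// ip_basis// subrr.
Qed.

End Elimination.

(** * Rank at most 2 for shallow nests *)

Section ShallowNests.
Context {R : realType} {H : hilbertType R}.
Variables (N : omega_nest H) (e : nat -> H) (n : nat -> nat) (rho t : nat).
Hypotheses (oe : orthosys xpredT e) (te : total_system e).
Hypothesis n_gt0 : forall k, (0 < n k.+1)%N.
Let s := partial_dim n.
Hypothesis (Ns : forall k, N k = span_upto e (s k)).
Hypothesis shallow : forall kappa, ~ geometric_chain n rho t kappa.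

(** For a proper ancestor, the factor [rho + 2] in [iter_parent_dom] is at least 2, so the atoms
    after [k] up to that of [a] have total dimension at most [(n k)./2]. *)
Lemma ancestor_near i a (k := iter i (parent n rho) (block n a).+1) :
  (0 < k)%N -> near_block n k a.
Proof.
case: i @k => [|i] k k0.
  rewrite /near_block /k /=; have := eqxx (block n a); rewrite blockP// => /andP[-> ba].
  by rewrite ltn_addr.
have dom := iter_parent_dom n_gt0 k0; rewrite -/k in dom.
have kb : (k < (block n a).+1)%N.
  rewrite ltnNge; apply/negP => bk; move: k0; rewrite /k iterS => k0.
  have := parent_iter_le n rho i (block n a).+1.
  have : (0 < iter i (parent n rho) (block n a).+1)%N by move: k0; case: (iter _ _ _).
  move=> /(@parent_lt n rho); rewrite -iterS -/k => h1 h2.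
  by have := leq_trans h1 h2; rewrite ltnNge bk.
have := eqxx (block n a); rewrite blockP// => /andP[ba ab]; apply/andP; split.
  apply: leq_trans ba; apply: partial_dim_le; exact: leq_trans (leq_pred k) kb.
apply: leq_trans ab _; rewrite -leq_subLR geq_half_double -mul2n (leq_trans _ dom)//.
by rewrite leq_mul2r; apply/orP; right; lia.
Qed.

Theorem shallow_rtsr_candidate2 : rtsr_candidate (nest_algebra N) 2.
Proof.
apply/rtsr_candidateP; split=> // A0 eps eps0.
(* [V j] embeds [H] as the [j]-th of two copies, interleaved by parity, and [W j] projects back; the
   row becomes one operator [A] with [A V_j = A0 j]. *)
pose half (j : 'I_2) c := if odd c == j :> nat then e c./2 else 0.
have ohalf (j : 'I_2) : orthosys (fun c => odd c == j :> nat) (half j).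
  move=> a b; rewrite /half; case: ifP => aj; last by rewrite ip0l andbF.
  case: ifP => bj; last by rewrite ip0r; case: eqP => // ab; rewrite ab bj in aj.
  rewrite ip_basis// andbT; congr (nat_of_bool _)%:R; apply/eqP/eqP => [ab|->//].
  by rewrite -(odd_double_half a) -(odd_double_half b) ab (eqP aj) (eqP bj).
have odbl (j : 'I_2) : orthosys xpredT (fun a => e (j + a.*2)%N).
  by move=> a b; rewrite ip_basis// eqn_add2l -!mul2n eqn_pmul2l// andbT.
have [W We] : exists W : 'I_2 -> bounded_operator H, forall j c, W j (e c) = half j c.
  exists (fun j => projT1 (diagop_basis oe (ohalf j))) => j c.
  by have [+ _] := projT2 (diagop_basis oe (ohalf j)); apply.
have [V Ve V1] : exists2 V : 'I_2 -> bounded_operator H, forall j a, V j (e a) = e (j + a.*2)%N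
    & forall j, `|V j| <= 1.
  exists (fun j => projT1 (diagop_basis oe (odbl j))) => [j a|j].
    by have [+ _] := projT2 (diagop_basis oe (odbl j)); apply.
  by have [] := projT2 (diagop_basis oe (odbl j)).
have [A Ax] : exists A : bounded_operator H, forall x, A x = \sum_j A0 j (W j x).
  by exists (\sum_j bop_mul (A0 j) (W j)) => x; rewrite bop_sum.
have triA0 T : maps_filtration e s s (nest_op (T : nest_algebra N)).
  by move=> k x; rewrite -!Ns; exact: nest_stable.
have triW j : maps_filtration e (fun k => 2 * s k)%N s (W j).
  apply: maps_filtration_basis => // k c ck; rewrite We /half; case: ifP => _.
    by apply: span_upto_basis => //; rewrite ltn_half_double -mul2n.
  by move=> b _; rewrite ip0l.
have triV j : maps_filtration e s (fun k => 2 * s k)%N (V j).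
  apply: maps_filtration_basis => // k a ak; rewrite Ve.
  by apply: span_upto_basis => //; have := ltn_ord j; lia.
have triA : maps_filtration e (fun k => 2 * s k)%N s A.
  move=> k x xk b kb; rewrite Ax ip_suml big1// => j _.
  exact: (triA0 _ _ _ (triW j _ _ xk)).
pose C := zone_const rho t.
have zone k : (0 < k)%N -> (s k - s (parent n rho k) <= 2 * C * uphalf (n k))%N.
  move=> k0; apply: leq_trans (parent_zone shallow k0) _.
  rewrite -/C -mulnA mulnCA leq_mul2l; apply/orP; right.
  by have := odd_double_half (n k); rewrite uphalf_half; lia.
have C0 : (0 < 2 * C)%N by rewrite /C /zone_const muln_gt0 expn_gt0 muln_gt0 !addn1.
have eps20 : 0 < eps / 2 by rewrite divr_gt0.
have parent0 : parent n rho 0 = 0%N by [].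
have [A' [B [A'A triA' triB AB]]] := elimination oe te n_gt0 parent0
  (@parent_lt n rho) zone (parent_depth n_gt0 shallow) ancestor_near C0 triA eps20.
have WV j l a : W j (V l (e a)) = if j == l then e a else 0.
  rewrite Ve We /half oddD odd_double addbF -val_eqE /=.
  have -> : (odd l : nat) = l by case: l => -[|[|]].
  rewrite eq_sym; case: eqP => // _.
  suff -> : ((l + a.*2)./2 = a)%N by [].
  by have := ltn_ord l; rewrite halfD odd_double andbF doubleK; case: l => -[|[|]].
have AV j : bop_mul A (V j) = A0 j.
  apply: (bop_ext (N := N)) => k x; rewrite Ns => /(span_expand oe te) ->.
  rewrite !bop_comb; apply: eq_bigr => a _; congr (_ *: _); rewrite /= Ax.
  rewrite (bigD1 j)//= WV eqxx big1 ?addr0// => l /negPf lj.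
  by rewrite WV lj bop0.
have A'N j : bop_mul A' (V j) \in in_nest_algebra N.
  by apply/in_nest_algebraP => k x; rewrite !Ns => xk; apply: triA'; exact: triV.
have BN j : bop_mul (W j) B \in in_nest_algebra N.
  by apply/in_nest_algebraP => k x; rewrite !Ns => xk; apply: triW; exact: triB.
exists (fun j => NestAlgebra (A'N j)), (fun j => NestAlgebra (BN j)); split.
  move=> j; rewrite nest_normE /= -AV.
  have -> : bop_mul A' (V j) - bop_mul A (V j) = bop_mul (A' - A) (V j) by exact/bopP.
  rewrite (le_lt_trans (bop_norm_mul _ _))// (@le_lt_trans _ _ (`|A' - A|))//.
    by rewrite ler_piMr.
  by rewrite (le_lt_trans A'A)// ltr_pdivrMr// ltr_pMr// ltr1n.
(* The two copies exhaust [H], so the products of the entries [A' V_j] and [W_j B] add up to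
   [A' B]. *)
have VW c : \sum_j V j (W j (e c)) = e c.
  rewrite !big_ord_recl big_ord0 addr0 !We /half /=.
  case: (boolP (odd c)) => oc /=; rewrite bop0 ?add0r ?addr0 Ve /=.
    by congr e; rewrite -[RHS]odd_double_half oc.
  by congr e; rewrite -[RHS]odd_double_half (negPf oc).
have VWy k y : span_upto e (2 * s k) y -> \sum_j V j (W j y) = y.
  move=> /(span_expand oe te) ->; under eq_bigr do rewrite !bop_comb.
  rewrite exchange_big; apply: eq_bigr => c _.
  by rewrite -scaler_sumr VW.
apply: val_inj; apply: (bop_ext (N := N)) => k x; rewrite Ns => xk.
transitivity (\sum_j A' (V j (W j (B x)))).
  elim/big_rec2: _ => [//|j y T _ <-]; by [].
rewrite -linear_sum (VWy k); last exact: triB.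
rewrite /= [in LHS](span_expand oe te xk) [RHS](span_expand oe te xk) !bop_comb.
by apply: eq_bigr => a _; rewrite AB.
Qed.

End ShallowNests.

(** * Comparison of the two nests *)

Unset Implicit Arguments.

Theorem corollary8p4 (R : realType) (H1 H2 : hilbertType R)
    (N : omega_nest H1) (M : omega_nest H2) (n m : nat -> nat)
    (hn : forall k : nat, (1 <= k)%N -> has_dim (atom N k) (n k))
    (hm : forall k : nat, (1 <= k)%N -> has_dim (atom M k) (m k))
    (c d : R) (hc : 0 < c) (hcd : c <= d)
    (hnm : forall k : nat, (1 <= k)%N ->
      c * (n k)%:R <= (m k)%:R /\ (m k)%:R <= d * (n k)%:R) :
  rtsr (nest_algebra N) = rtsr (nest_algebra M).
Proof.
have [e [oe te n0 Ne]] := nest_basis hn; have [f [of' tf m0 Mf]] := nest_basis hm.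
(* The rank depends only on whether the sequence of dimensions is deep, so [deep_equiv] will finish
   the proof. *)
have rtsrE (H : hilbertType R) (N' : omega_nest H) (u : nat -> H) (l : nat -> nat) :
    orthosys xpredT u -> total_system u -> (forall k, 0 < l k.+1)%N ->
    (forall k, N' k = span_upto u (partial_dim l k)) ->
    rtsr (nest_algebra N') = if pselect (deep l) then None else Some 2%N.
  move=> ou tu l0 Nu; case: pselect => [dl|ndl].
    apply: rtsr_none => p cp; apply: (deep_not_rtsr_candidate ou tu l0 Nu dl _ cp).
    by case/rtsr_candidateP: cp.
  apply: rtsr_two; last exact: (not_rtsr_candidate1 ou tu l0 Nu).
  move/existsNP: ndl => [rho /existsNP[t /forallNP shallow]].
  exact: (shallow_rtsr_candidate2 ou tu l0 Nu shallow).
rewrite (rtsrE _ _ _ _ oe te n0 Ne) (rtsrE _ _ _ _ of' tf m0 Mf).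
(* A natural number above both [d] and [c^-1] bounds each sequence by the other. *)
pose q := maxn (truncn d).+1 (truncn c^-1).+1.
have nm k : (n k.+1 <= q * m k.+1)%N.
  rewrite -(ler_nat R) natrM; have [h _] := hnm k.+1 isT.
  apply: le_trans (_ : c^-1 * (m k.+1)%:R <= _).
    by rewrite ler_pdivlMl.
  rewrite ler_wpM2r// (le_trans (ltW (truncnS_gt _)))// ler_nat leq_maxr.
  by [].
have mn k : (m k.+1 <= q * n k.+1)%N.
  rewrite -(ler_nat R) natrM; have [_ h] := hnm k.+1 isT.
  apply: le_trans h _; rewrite ler_wpM2r// (le_trans (ltW (truncnS_gt _)))// ler_nat leq_maxl.
  by [].
by case: pselect => dn; case: pselect => dm //; exfalso;
  [apply: dm; exact: deep_equiv nm mn dn | apply: dn; exact: deep_equiv mn nm dm].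
Qed.
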